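(* Let $\phi:\mathbb{R}^d\to\mathbb{R}$ be given by $\phi(x)=\sqrt{2|x|}$ and set $F(x,m)=\phi(x)\int_{\mathbb{R}^d}\phi\,dm$. Fix a final time $T>0$. Set the final coupling $G(x,m)=-T|x|$ and the Lagrangian $$L(x,v,m)=\tfrac12|v|^2+F(x,m)=\tfrac12|v|^2+\phi(x)\int_{\mathbb{R}^d}\phi\,dm.$$ Then the Lasry–Lions monotonicity condition (LL) is satisfied strongly by $F$, but uniqueness of the mean field game equilibria does not hold for the initial measure $m_0=\delta_0$ (i.e. there are at least two distinct equilibria).
   Context: $\mathscr{P}_2(\mathbb{R}^d)$ is the set of Borel probability measures on $\mathbb{R}^d$ with finite second moment. (LL) for $F$: $\int_{\mathbb{R}^d}(F(x,m_1)-F(x,m_2))\,d(m_1-m_2)(x)\ge0$ for all $m_1,m_2\in\mathscr{P}_2(\mathbb{R}^d)$. It holds strongly if in addition equality implies that $F(\cdot,m_1)$ and $F(\cdot,m_2)$ are identical. Equilibria: let $\Gamma=\mathrm{AC}(0,T;\mathbb{R}^d)$ be the space of absolutely continuous curves on $[0,T]$ (with the topology of uniform convergence), $e_t(\gamma)=\gamma(t)$, $\Gamma[x]=\{\gamma\in\Gamma:\gamma(0)=x\}$. For $m_0\in\mathscr{P}_2(\mathbb{R}^d)$, $\mathscr{P}_{m_0}(\Gamma)$ is the set of Borel probability measures $\eta$ on $\Gamma$ with $(e_0)_\sharp\eta=m_0$, with disintegration $\eta(d\gamma)=\int\eta_x(d\gamma)\,dm_0(x)$, $\eta_x$ supported in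 $\Gamma[x]$. Put $J^\eta[\gamma]=\int_0^TL(\gamma_s,\dot\gamma_s,(e_s)_\sharp\eta)\,ds+G(\gamma_T,(e_T)_\sharp\eta)$ and let $\Gamma^\eta[x]$ be the set of minimizers of $J^\eta$ over $\Gamma[x]$. An equilibrium for $m_0$ is an $\eta\in\mathscr{P}_{m_0}(\Gamma)$ (with $(e_s)_\sharp\eta\in\mathscr{P}_2(\mathbb{R}^d)$ for all $s$) such that $\mathrm{spt}(\eta_x)\subseteq\Gamma^\eta[x]$ for $m_0$-a.e. $x$. *)

(* Defs.v *)
From HB Require Import structures.
From mathcomp Require Import all_boot all_order all_algebra.
From mathcomp Require Import all_classical all_reals all_analysis.

Set Implicit Arguments.
Unset Strict Implicit.
Unset Printing Implicit Defensive.

Import Order.TTheory GRing.Theory Num.Theory.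
Import numFieldNormedType.Exports.

Local Open Scope classical_set_scope.
Local Open Scope ring_scope.

Notation borel T := (g_sigma_algebraType (@open T)).

Definition msupport (R : realType) (T : topologicalType) (mu : set T -> \bar R)
  : set T := [set x | forall U, open_nbhs x U -> (0 < mu U)%E].

Section euclidean_space.
Context {R : realType} {d : nat}.
Implicit Types (x : 'rV[R]_d) (m : probability (borel 'rV[R]_d) R).

(* The library norm of 'rV[R]_d is the sup norm; it induces the same
   topology, hence the same Borel sets and the same derivatives. *)
Definition enorm x : R := Num.sqrt (\sum_i x ord0 i ^+ 2).

Definition P2 m : Prop := (\int[m]_x (enorm x ^+ 2)%:E < +oo)%E.

(* \int f d(m1 - m2) *)
Definition integral_diff (f : 'rV[R]_d -> R) m1 m2 : R :=
  \int[m1]_x f x - \int[m2]_x f x.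

(* Rintegral is a total function: the integrability of the integrand, implicit
   in the informal condition, is made explicit. *)
Definition LL_monotone (F : 'rV[R]_d -> probability (borel 'rV[R]_d) R -> R) :=
  forall m1 m2, P2 m1 -> P2 m2 ->
    let f := fun x => F x m1 - F x m2 in
    [/\ m1.-integrable setT (EFin \o f), m2.-integrable setT (EFin \o f) &
        0 <= integral_diff f m1 m2].

Definition LL_strongly_monotone
    (F : 'rV[R]_d -> probability (borel 'rV[R]_d) R -> R) :=
  LL_monotone F /\
  forall m1 m2, P2 m1 -> P2 m2 ->
    integral_diff (fun x => F x m1 - F x m2) m1 m2 = 0 ->
    forall x, F x m1 = F x m2.

Definition abs_continuous (a b : R) (f : R -> 'rV[R]_d) : Prop :=
  forall e : R, 0 < e -> exists2 delta : R, 0 < delta &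
    forall (n : nat) (u v : 'I_n -> R),
      (forall i, [/\ a <= u i, u i <= v i & v i <= b]) ->
      trivIset setT (fun i => [set` `]u i, v i[]) ->
      \sum_i (v i - u i) < delta ->
      \sum_i enorm (f (v i) - f (u i)) < e.

End euclidean_space.

(* A curve on [0, T] is represented by its extension to R that is constant on
   ]-oo, 0] and on [T, +oo[; uniform convergence on R and on [0, T] thus
   coincide. *)
Definition ac_curves {R : realType} (d : nat) (T : R)
  : set {uniform R -> 'rV[R]_d} :=
  [set g | abs_continuous 0 T g /\
           forall t, g t = g (Num.max 0 (Num.min t T))].
Arguments ac_curves {R} d T.

Definition curve {R : realType} (d : nat) (T : R) : Type :=
  set_type (ac_curves d T).

HB.instance Definition _ (R : realType) (d : nat) (T : R) :=
  Topological.copy (curve d T) (set_type (ac_curves d T)).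

Lemma ac_curves_cst (R : realType) (d : nat) (T : R) (x : 'rV[R]_d) :
  (cst x : {uniform R -> 'rV[R]_d}) \in ac_curves d T.
Proof.
rewrite inE; split=> // e e0; exists 1 => // n u v _ _ _.
rewrite big1// => i _; rewrite /cst subrr /enorm big1 ?sqrtr0// => j _.
by rewrite mxE expr0n.
Qed.

HB.instance Definition _ (R : realType) (d : nat) (T : R) :=
  isPointed.Build (curve d T) (SigSub (ac_curves_cst T 0)).

Definition curve_fun (R : realType) (d : nat) (T : R) (g : curve d T)
  : R -> 'rV[R]_d := \val g.
Coercion curve_fun : curve >-> Funclass.

Section evaluation.
Context {R : realType} {d : nat} {T : R}.

Definition eval (t : R) (g : borel (curve d T)) : borel 'rV[R]_d := curve_fun g t.

Lemma continuous_eval (t : R) : continuous (fun g : curve d T => g t).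
Proof.
have eval_unif : continuous (fun f : {uniform R -> 'rV[R]_d} => f t).
  move=> f A /= /nbhsP[E entE EA]; apply/uniform_nbhs.
  by exists E; split => // h fh; apply/EA/mem_set/fh.
move=> g; apply: (@continuous_comp (curve d T) {uniform R -> 'rV[R]_d} _
  set_val (fun f => f t)); last exact: eval_unif.
exact: initial_continuous.
Qed.

Lemma measurable_eval (t : R) : measurable_fun setT (eval t).
Proof.
apply: (@measurability _ _ _ _ _ (eval t) (@open 'rV[R]_d)) => // _ [U oU <-].
rewrite setTI; apply: sub_sigma_algebra.
by have /continuousP := @continuous_eval t; exact.
Qed.

HB.instance Definition _ (t : R) :=
  isMeasurableFun.Build _ _ _ _ (eval t) (measurable_eval t).

End evaluation.

Section mean_field_game.
Context {R : realType} {d : nat} {T : R}.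
Variable L : 'rV[R]_d -> 'rV[R]_d -> probability (borel 'rV[R]_d) R -> R.
Variable G : 'rV[R]_d -> probability (borel 'rV[R]_d) R -> R.
Implicit Type eta : probability (borel (curve d T)) R.

(* The kinetic part of the cost of an absolutely continuous curve may be
   infinite. *)
Definition cost eta (g : curve d T) : \bar R :=
  (\int[lebesgue_measure]_(s in `[0%R, T])
     (L (g s) (derive1 g s) (distribution eta (eval s)))%:E +
   (G (g T) (distribution eta (eval T)))%:E)%E.

Definition minimizers eta (x : 'rV[R]_d) : set (curve d T) :=
  [set g : curve d T | g 0 = x /\
           forall h : curve d T, h 0 = x -> (cost eta g <= cost eta h)%E].

Definition disintegration (m0 : probability (borel 'rV[R]_d) R) eta
    (k : R.-pker (borel 'rV[R]_d) ~> (borel (curve d T))) : Prop :=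
  (forall A, measurable A -> eta A = \int[m0]_x k x A)%E /\
  {ae m0, forall x, k x [set g : curve d T | g 0 = x] = 1%E}.

(* Measures are compared on measurable sets only: the value of a library
   measure on other sets is unspecified. *)
Definition equilibrium (m0 : probability (borel 'rV[R]_d) R) eta : Prop :=
  [/\ forall A, measurable A -> distribution eta (eval 0) A = m0 A,
      forall s, s \in `[0, T] -> P2 (distribution eta (eval s)) &
      exists2 k, disintegration m0 eta k &
        {ae m0, forall x, msupport (k x) `<=` minimizers eta x}].

End mean_field_game.

Section example.
Context {R : realType} {d : nat}.
Implicit Types (x v : 'rV[R]_d) (m : probability (borel 'rV[R]_d) R).

Definition phi x : R := Num.sqrt (2 * enorm x).

Definition running_coupling x m : R := phi x * \int[m]_y phi y.

Definition final_coupling (T : R) x m : R := - T * enorm x.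

Definition lagrangian x v m : R :=
  2^-1 * enorm v ^+ 2 + running_coupling x m.

End example.

(* Main.v *)
Require Import Defs.
From HB Require Import structures.
From mathcomp Require Import all_boot all_order all_algebra.
From mathcomp Require Import all_classical all_reals all_analysis.
From mathcomp Require Import measurable_realfun.
From mathcomp Require Import lra ring.

Set Implicit Arguments.
Unset Strict Implicit.
Unset Printing Implicit Defensive.

Import Order.TTheory GRing.Theory Num.Theory.
Import numFieldNormedType.Exports.

Local Open Scope classical_set_scope.
Local Open Scope ring_scope.

(** The coupling is a product phi(x) * \int phi dm, so the monotonicity integral
    of two measures is the square of the difference of their two means of phi.
    It is thus nonnegative, and it vanishes only if the means, hence the
    couplings, agree.

    For non-uniqueness, the reflection x |-> -x preserves all the data and fixes
    the Dirac mass at 0. It is therefore enough to find an equilibrium that is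
    carried by curves in one closed half-line and that does not leave all the
    mass at the origin; its mirror image is a different equilibrium. On a
    half-line only the distance f >= 0 to the origin matters. If a(s) is the mean
    of phi at time s, a curve costs
      cost1 a f = E(f) - T * f(T) + \int_0^T a(s) sqrt(2 f(s)) ds,
    where E is the kinetic energy.

    The curve t^2/2 solves the Euler-Lagrange equation when the mass follows it,
    but the second variation is indefinite near t = 0 (it is the Hardy functional
    with constant 1 > 1/4), so that this explicit candidate is not an
    equilibrium. Existence is obtained by minimisation instead: the equilibrium
    condition is the first order condition for the convex functional
      Lambda |-> Lambda(E - T f(T)) + 1/2 \int_0^T Lambda(phi1(f(s)))^2 ds
    over probabilities Lambda on curves. Lambda ranges here over positive
    normalised linear functionals (mean), which makes approximate minimisers
    available at once (approximate_equilibrium). A limit along an ultrafilter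
    gives a continuous profile a and a value V such that V <= cost1 a f for all
    curves, while the means of cost1 a tend to V (cost_equilibrium).

    The limit has to be turned into a countably additive law. The curves of
    bounded energy are cut into finitely many cells of small diameter, nested from
    one level to the next; the limit masses of the cells are the lengths of nested
    intervals of [0,1[, and a point w of [0,1[ selects a curve X w in the
    intersection of its cells. Lower semicontinuity of the energy makes every X w
    optimal, and the mean of phi1(X w s) over w is a(s) (random_equilibrium).

    Finally the scalar problem controls competitors in R^d: |h| has at most the
    kinetic energy of h (row_ac_density), and a curve of energy above 2 T^3 never
    pays off, since the terminal gain is at most T sqrt(2 T E) (action_ge). If the
    law were concentrated on curves with X w T = 0, it would be the rest curve, the
    profile a would vanish and uniform motion at speed T would have a negative
    cost, against V = 0 (reaches_final_time). *)

(** * Absolutely continuous functions *)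

Section absolute_continuity.
Context {R : realType}.
Implicit Types f : R -> R.

Definition ac f := forall e : R, 0 < e -> exists2 delta : R, 0 < delta &
  forall (I : finType) (u v : I -> R), (forall i, u i <= v i) ->
    trivIset setT (fun i => [set` `]u i, v i[]) ->
    \sum_i (v i - u i) < delta -> \sum_i `|f (v i) - f (u i)| < e.

Lemma nodes_itv_partition (a b : R) (s : seq R) : itv_partition a b s ->
  let F := nth b (a :: s) in
  {homo F : i j / (i <= j)%N >-> i <= j} /\ forall i, a <= F i <= b.
Proof.
move=> [/(pathP b) ps /eqP lb] F.
have Fb i : (size s <= i)%N -> F i = b.
  rewrite leq_eqVlt => /predU1P[<-|si]; last by rewrite /F nth_default.
  by rewrite /F nth_last.
have FS i : F i <= F i.+1.
  have [si|si] := ltnP i (size s); first exact/ltW/ps.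
  by rewrite !Fb// ltnW.
have Fmono : {homo F : i j / (i <= j)%N >-> i <= j} by exact: (homo_leq lexx le_trans).
split=> // i; apply/andP; split; first exact: (Fmono 0%N).
by rewrite -(Fb (maxn i (size s)) (leq_maxr _ _)); exact/Fmono/leq_maxl.
Qed.

(** Nearly optimal subdivisions of all the intervals form together one family of
    disjoint intervals of the same total length, to which absolute continuity
    applies. *)
Lemma ac_total_variation f : ac f -> forall e : R, 0 < e ->
  exists2 delta : R, 0 < delta & forall (I : finType) (u v : I -> R),
    (forall i, u i <= v i) ->
    trivIset setT (fun i => [set` `]u i, v i[]) ->
    \sum_i (v i - u i) < delta ->
    (\sum_i total_variation (u i) (v i) f <= e%:E)%E.
Proof.
move=> acf e e0; have [delta d0 H] := acf e e0; exists delta => // I u v uv tuv sd.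
have key (s : I -> seq R) : (forall i, itv_partition (u i) (v i) (s i)) ->
    \sum_i variation (u i) (v i) f (s i) <= e.
  move=> ps; pose m := \max_i size (s i).
  (* the default v i pads all the subdivisions to m nodes with empty intervals *)
  pose F i j := nth (v i) (u i :: s i) j.
  have Fmono i := (nodes_itv_partition (ps i)).1.
  have Fb i j : u i <= F i j <= v i by have [_ /(_ j)] := nodes_itv_partition (ps i).
  have Fv i j : (size (s i) <= j)%N -> F i j = v i.
    rewrite leq_eqVlt => /predU1P[<-|si]; last by rewrite /F nth_default.
    by rewrite /F nth_last /=; have [_ /eqP] := ps i.
  have E (h : R -> R -> R) i : (h (v i) (v i) = 0) ->
      \sum_(0 <= n < size (s i)) h (F i n) (F i n.+1)
      = \sum_(j < m) h (F i j) (F i j.+1).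
    move=> h0; rewrite -(big_mkord xpredT (fun j => h (F i j) (F i j.+1))).
    rewrite (@big_cat_nat _ _ _ (size (s i)) 0 m)//=; last first.
      exact: (leq_bigmax_cond (F := fun i => size (s i))).
    rewrite [X in _ = _ + X]big_nat [X in _ = _ + X]big1 ?addr0// => j /andP[sj _].
    by rewrite !Fv// ltnW.
  have := H (I * 'I_m)%type (fun p => F p.1 p.2) (fun p => F p.1 p.2.+1).
  have -> : \sum_(p : I * 'I_m) `|f (F p.1 p.2.+1) - f (F p.1 p.2)| =
            \sum_i variation (u i) (v i) f (s i).
    rewrite -(pair_bigA _ (fun i (j : 'I_m) => `|f (F i j.+1) - f (F i j)|))/=.
    apply: eq_bigr => i _; rewrite -(E (fun x y => `|f y - f x|))//.
    by rewrite subrr normr0.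
  have -> : \sum_(p : I * 'I_m) (F p.1 p.2.+1 - F p.1 p.2) = \sum_i (v i - u i).
    rewrite -(pair_bigA _ (fun i (j : 'I_m) => (F i j.+1 - F i j)))/=.
    apply: eq_bigr => i _; rewrite -(E (fun x y => y - x)) ?subrr//.
    by rewrite telescope_sumr// Fv.
  move=> H'; apply/ltW/H' => //.
    by move=> [i j] /=; exact: Fmono.
  move=> [i j] [i' j'] _ _ /= [x [/=]]; rewrite !in_itv/= => /andP[x1 x2] /andP[x3 x4].
  have ii : i = i'.
    apply: (tuv i i') => //; exists x; split; rewrite /= in_itv/=.
      by have /andP[? _] := Fb i j; have /andP[_ ?] := Fb i j.+1; apply/andP; split; [exact: le_lt_trans x1|exact: lt_le_trans x2 _].
    by have /andP[? _] := Fb i' j'; have /andP[_ ?] := Fb i' j'.+1; apply/andP; split; [exact: le_lt_trans x3|exact: lt_le_trans x4 _].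
  move: x3 x4; rewrite -ii => x3 x4; congr pair.
  apply/val_inj/eqP; rewrite eqn_leq; apply/andP; split; rewrite leqNgt; apply/negP => jj.
    by have := lt_trans x1 (lt_le_trans x4 (Fmono i _ _ jj)); rewrite ltxx.
  by have := lt_trans x3 (lt_le_trans x2 (Fmono i _ _ jj)); rewrite ltxx.
have fin_TV i : total_variation (u i) (v i) f \is a fin_num.
  rewrite ge0_fin_numE ?total_variation_ge0//.
  apply: (@le_lt_trans _ _ e%:E); last exact: ltry.
  apply: ge_ereal_sup => _ /= [_ [s ps <-] <-]; rewrite lee_fin.
  have ps0 (k : I) : exists s, itv_partition (u k) (v k) s.
    have := uv k; rewrite le_eqVlt => /predU1P[->|uvk].
      by exists [::]; split => //=.
    by exists [:: v k]; split; rewrite //= uvk.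
  pose t k := if k == i then s else projT1 (cid (ps0 k)).
  have pt k : itv_partition (u k) (v k) (t k).
    rewrite /t; case: eqP => [->//|_]; exact: (projT2 (cid (ps0 k))).
  apply: le_trans (key t pt); rewrite (bigD1 i)//= {1}/t eqxx lerDl.
  by apply: sumr_ge0 => k _; exact: sumr_ge0.
apply/lee_addgt0Pr => r r0.
have N0 : 0 < r / (#|I|.+1)%:R by rewrite divr_gt0.
have ex i : exists s, itv_partition (u i) (v i) s /\
    (total_variation (u i) (v i) f <= (variation (u i) (v i) f s + r / (#|I|.+1)%:R)%:E)%E.
  have [_ [_ [s ps <-] <-] h] := ub_ereal_sup_adherent N0 (fin_TV i).
  by exists s; split => //; rewrite EFinD -leeBlDr// ltW.
pose s i := projT1 (cid (ex i)).
have ps i := (projT2 (cid (ex i))).1.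
have hs i := (projT2 (cid (ex i))).2.
apply: (@le_trans _ _ (\sum_i (variation (u i) (v i) f (s i) + r / (#|I|.+1)%:R)%:E)%E).
  exact: lee_sum.
rewrite sumEFin lee_fin big_split/= lerD ?key//.
rewrite sumr_const -[leLHS]mulr_natl mulrA ler_pdivrMr// mulrC ler_wpM2l ?ltW//.
by rewrite ltr_nat ltnS.
Qed.

Lemma acB f g : ac f -> ac g -> ac (fun t => f t - g t).
Proof.
move=> acf acg e e0; have e20 : 0 < e / 2 by rewrite divr_gt0.
have [d1 d10 H1] := acf _ e20; have [d2 d20 H2] := acg _ e20.
exists (Num.min d1 d2); first by rewrite lt_min d10.
move=> I u v uv tuv; rewrite lt_min => /andP[s1 s2].
apply: (@le_lt_trans _ _ (\sum_i (`|f (v i) - f (u i)| + `|g (v i) - g (u i)|))).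
  apply: ler_sum => i _; rewrite (_ : f _ - _ - _ = (f (v i) - f (u i)) - (g (v i) - g (u i))); last by ring.
  exact: ler_normB.
by rewrite big_split/= [e]splitr ltrD// ?H1// H2.
Qed.

Lemma ac_small f : ac f -> forall e : R, 0 < e -> exists2 delta : R, 0 < delta &
  forall u v, u <= v -> v - u < delta -> `|f v - f u| < e.
Proof.
move=> acf e e0; have [d d0 H] := acf e e0; exists d => // u v uv vu.
have := H 'I_1 (fun=> u) (fun=> v); rewrite !big_ord1; apply=> //.
by move=> i j _ _ _; rewrite !ord1.
Qed.

Lemma ac_continuous f : ac f -> continuous f.
Proof.
move=> acf x; apply/cvgrPdist_lt => e e0; have [d d0 H] := ac_small acf e0.
near=> y; have : `|x - y| < d by near: y; apply/nbhs_normP; exists d.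
have [xy|/ltW yx] := leP x y.
  by rewrite distrC ger0_norm ?subr_ge0// distrC; exact: H.
by rewrite ger0_norm ?subr_ge0//; exact: H.
Unshelve. all: by end_near. Qed.

Lemma ac_total_variation_fin f a b : ac f -> a <= b ->
  total_variation a b f \is a fin_num.
Proof.
move=> acf ab; have [d d0 H] := ac_total_variation acf ltr01.
pose n := (Num.bound ((b - a) / d)).+1; pose h := (b - a) / n%:R.
have h0 : 0 <= h by rewrite divr_ge0// subr_ge0.
have hd : h < d.
  rewrite ltr_pdivrMr// mulrC -ltr_pdivrMr//.
  apply: (lt_trans (archi_boundP _)); last by rewrite ltr_nat.
  by rewrite divr_ge0 ?subr_ge0// ltW.
suff P k : total_variation a (a + k%:R * h) f \is a fin_num.
  have := P n; rewrite /h mulrC -mulrA mulVf ?mulr1 ?pnatr_eq0//.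
  by rewrite addrC subrK.
elim: k => [|k IH]; first by rewrite mul0r addr0 total_variationxx.
have ak : a <= a + k%:R * h by rewrite lerDl mulr_ge0.
have kk : a + k%:R * h <= a + k.+1%:R * h by rewrite lerD2l ler_wpM2r// ler_nat.
rewrite (total_variationD _ ak kk) fin_numD IH/=.
rewrite ge0_fin_numE ?total_variation_ge0//.
apply: le_lt_trans (ltry 1); have := H 'I_1 (fun=> a + k%:R * h) (fun=> a + k.+1%:R * h).
rewrite !big_ord1; apply => //; first by move=> i j _ _ _; rewrite !ord1.
by rewrite -natr1 mulrDl mul1r (_ : _ - _ = h)//; ring.
Qed.

End absolute_continuity.

(** * Clamping to the time interval *)
Section clamp.
Context {R : realType}.
Variable T : R.
Hypothesis T0 : 0 < T.

Definition clamp (t : R) : R := Num.max 0 (Num.min t T).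

Lemma clamp_itv t : 0 <= clamp t <= T.
Proof. by rewrite le_max lexx/= ge_max ltW//= ge_min lexx orbT. Qed.

Lemma clamp_id t : 0 <= t <= T -> clamp t = t.
Proof. by move=> /andP[t0 tT]; rewrite /clamp min_l// max_r. Qed.

Lemma clampK t : clamp (clamp t) = clamp t.
Proof. exact/clamp_id/clamp_itv. Qed.

Lemma le_clamp s t : s <= t -> clamp s <= clamp t.
Proof. by move=> st; rewrite ge_max le_max lexx/= le_max le_min !ge_min st lexx !orbT. Qed.

Lemma clampB s t : s <= t -> clamp t - clamp s <= t - s.
Proof.
move=> st; rewrite lerBlDr {1}/clamp ge_max.
have /andP[s0 _] := clamp_itv s; rewrite addr_ge0 ?subr_ge0//=.
have [sT|Ts] := leP s T.
  apply: (@le_trans _ _ t); first by rewrite ge_min lexx.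
  by rewrite -lerBlDl opprB addrCA subrr addr0 /clamp min_l// le_max lexx orbT.
apply: (@le_trans _ _ T); first by rewrite ge_min lexx orbT.
apply: (@le_trans _ _ (clamp s)); last by rewrite lerDr subr_ge0.
by rewrite /clamp min_r ?(ltW Ts)// le_max lexx orbT.
Qed.

Lemma clamp_oo s t : `]clamp s, clamp t[ `<=` `]s, t[.
Proof.
move=> x /=; rewrite !in_itv/= /clamp gt_max gt_min lt_max lt_min.
move=> /andP[/andP[x0 sx] xt]; apply/andP; split.
  have /orP[//|Tx] := sx; case/orP: xt => [|/andP[_ xT]]; first by rewrite ltNge ltW.
  by have := lt_trans xT Tx; rewrite ltxx.
by have /orP[|/andP[//]] := xt; rewrite ltNge ltW.
Qed.

Lemma fine_total_variationB f s t : ac f -> s <= t ->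
  fine (total_variation 0 (clamp t) f) - fine (total_variation 0 (clamp s) f)
    = fine (total_variation (clamp s) (clamp t) f).
Proof.
move=> acf st; have /andP[s0 _] := clamp_itv s.
rewrite (total_variationD f s0 (le_clamp st)) fineD ?ac_total_variation_fin ?le_clamp//.
by rewrite addrAC subrr add0r.
Qed.

(** One of the two monotone parts of the Jordan decomposition; the other one is its
    difference with f. *)
Lemma ac_clamped_total_variation f : ac f ->
  ac (fun t => fine (total_variation 0 (clamp t) f)) /\
  {homo (fun t => fine (total_variation 0 (clamp t) f)) : s t / s <= t}.
Proof.
move=> acf.
have E s t := @fine_total_variationB f s t acf.
split; last first.
  by move=> s t st; rewrite -subr_ge0 E// fine_ge0// total_variation_ge0// le_clamp.
move=> e e0; have e20 : 0 < e / 2 by rewrite divr_gt0.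
have [d d0 H] := ac_total_variation acf e20; exists d => // I u v uv tuv sd.
have := H I (clamp \o u) (clamp \o v) => {}H.
apply: (@le_lt_trans _ _ (e / 2)); last by rewrite ltr_pdivrMr// mulr2n mulrDr mulr1 ltrDl.
rewrite -lee_fin; apply: le_trans (H _ _ _) => //.
- rewrite -sumEFin; apply: lee_sum => i _.
  rewrite E// ger0_norm ?fine_ge0 ?total_variation_ge0 ?le_clamp//.
  by rewrite fineK// ac_total_variation_fin// le_clamp.
- by move=> i; exact: le_clamp.
- move=> i j _ _ [x [xi xj]]; apply: tuv => //; exists x.
  by split; exact: clamp_oo.
- by apply: le_lt_trans sd; apply: ler_sum => i _; exact: clampB.
Qed.

End clamp.

(** * Densities of absolutely continuous functions *)
Section density.
Context {R : realType}.
Notation mu := (@lebesgue_measure R).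

Lemma lebesgue_stieltjes_itv_oc (p : cumulative R R) (a b : R) : a <= b ->
  lebesgue_stieltjes_measure p `]a, b] = (p b - p a)%:E.
Proof.
move=> ab; rewrite /lebesgue_stieltjes_measure /measure_extension.
by rewrite measurable_mu_extE/= ?wlength_itv_bnd//; exact: is_ocitv.
Qed.

Lemma open_interval_oo (J : set R) (l : R) : open J -> is_interval J ->
  (mu J < l%:E)%E -> exists a b, a <= b /\ J = `]a, b[%classic.
Proof.
move=> oJ /is_intervalP JE muJ.
have [J0|/set0P[x0 Jx0]] := eqVneq J set0.
  by exists 0, 0; rewrite lexx; split=> //; rewrite J0 set_itvoo0.
have ball x : J x -> exists2 e : R, 0 < e & forall y, `|x - y| < e -> J y.
  by move=> Jx; have /nbhs_normP[e /= e0 He] := oJ x Jx; exists e.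
move: muJ ball Jx0; rewrite JE; move: (Rhull J) => [lo hi] {JE oJ}.
rewrite lebesgue_measure_itv/=.
case: lo => [bl a|[|]]; case: hi => [br b|[|]] //=;
  rewrite ?lte_fin ?ltry ?ltNyr//; last by move=> _ _; rewrite in_itv/= andbF.
move=> _ ball; rewrite in_itv/= => /andP[lx xr].
have axb : a <= x0 <= b.
  by apply/andP; split; [move: lx; case: (bl)|move: xr; case: (br)] => // /ltW.
have ab : a <= b by have /andP[] := axb; exact: le_trans.
exists a, b; split=> //.
have -> : bl = false.
  apply/negbTE/negP => bl1; rewrite bl1 in ball.
  have [|e e0 He] := ball a.
    have /andP[h _] := axb.
    by rewrite in_itv/= lexx/=; move: xr; case: (br) => /=; [exact: le_lt_trans|exact: le_trans].
  have := He (a - e / 2); rewrite in_itv/= opprB addrCA subrr addr0.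
  have e20 : 0 < e / 2 by rewrite divr_gt0.
  rewrite ger0_norm ?(ltW e20)// ltr_pdivrMr// mulr2n mulrDr mulr1 ltrDl => /(_ e0).
  by rewrite lerBrDl gerDr leNgt e20.
suff -> : br = true by [].
  apply/negPn/negP => br0; move/negbTE: br0 => br0; rewrite br0 in ball.
  have [|e e0 He] := ball b.
    have /andP[_ h] := axb.
    by rewrite in_itv/= lexx/= andbT; move: lx; case: (bl) => /= h'; [exact: le_trans h|exact: lt_le_trans h].
  have := He (b + e / 2); rewrite in_itv/= opprD addrA subrr sub0r normrN.
  have e20 : 0 < e / 2 by rewrite divr_gt0.
  rewrite ger0_norm ?(ltW e20)// ltr_pdivrMr// mulr2n mulrDr mulr1 ltrDl => /(_ e0).
  by rewrite gerDl leNgt e20 andbF.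
Qed.

(** A null set has an open neighbourhood of small measure, whose components are
    disjoint intervals of small total length. *)
Lemma ac_dominates (p : cumulative R R) : ac p ->
  lebesgue_stieltjes_measure p `<< mu.
Proof.
move=> acp; apply/null_content_dominatesP => N mN N0.
apply/eqP; rewrite eq_le measure_ge0 andbT; apply/lee_addgt0Pr => e e0; rewrite add0e.
have [d d0 H] := acp e e0.
have N_fin : (mu N < +oo)%E by rewrite [mu N]N0.
have [U [oU NU muUN]] := lebesgue_regularity_outer mN N_fin d0.
have mU : measurable U := measurable_realfun.open_measurable oU.
have muU : (mu U < d%:E)%E.
  have UE : U = (U `\` N) `|` N.
    by rewrite setUC setDUK.
  rewrite UE; apply: le_lt_trans muUN.
  apply: (le_trans (measureU2 _ _ _)) => //; first exact: measurableD.
  by rewrite [X in (_ + X)%E]N0 adde0.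
pose J := open_disjoint_itv oU.
have UE : U = \bigcup_k J k := open_disjoint_itv_bigcup oU.
have mJ k : measurable (J k).
  by apply: measurable_realfun.open_measurable; exact: open_disjoint_itv_open.
have tJ : trivIset setT J := @open_disjoint_itv_trivIset _ _ oU.
have muJ k : (mu (J k) < d%:E)%E.
  apply: le_lt_trans muU; apply: le_measure; rewrite ?inE//; first exact: mJ.
  by rewrite UE; exact: bigcup_sup.
have ex k : exists ab : R * R, ab.1 <= ab.2 /\ J k = `]ab.1, ab.2[%classic.
  have [a [b h]] := open_interval_oo (@open_disjoint_itv_open _ _ oU k)
    (@open_disjoint_itv_is_interval _ _ oU k) (muJ k).
  by exists (a, b).
pose ab k := projT1 (cid (ex k)).
have ab_le k : (ab k).1 <= (ab k).2 := (projT2 (cid (ex k))).1.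
have JE k : J k = `](ab k).1, (ab k).2[%classic := (projT2 (cid (ex k))).2.
apply: (@le_trans _ _ (lebesgue_stieltjes_measure p U)).
  by apply: le_measure; rewrite ?inE.
rewrite UE measure_bigcup//; last by move=> k _; exact: mJ.
apply: lime_le; first by apply: is_cvg_nneseries => *; exact: measure_ge0.
apply: nearW => n; rewrite big_mkord.
rewrite (eq_bigl xpredT); last by move=> k; rewrite in_setT.
apply: (@le_trans _ _ (\sum_(k < n) (p (ab k).2 - p (ab k).1)%:E)%E).
  apply: lee_sum => k _; rewrite -lebesgue_stieltjes_itv_oc//.
  apply: (le_measure (lebesgue_stieltjes_measure p)); rewrite ?inE ?JE//.
  by apply: subset_itvl; rewrite bnd_simp.
rewrite sumEFin lee_fin; apply/ltW.
apply: (@le_lt_trans _ _ (\sum_(k < n) `|p (ab k).2 - p (ab k).1|)).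
  by apply: ler_sum => k _; exact: ler_norm.
apply: H => //.
  move=> i j _ _ h; apply/val_inj/(tJ i j) => //.
  by rewrite !JE.
rewrite -lte_fin -sumEFin; apply: le_lt_trans muU.
rewrite UE; apply: (@le_trans _ _ (\sum_(k < n) mu (J k))%E).
  apply: lee_sum => k _; rewrite JE lebesgue_measure_itv/= lte_fin.
  by case: ltP (ab_le k) => // h1 h2; rewrite (le_anti (introT andP (conj h1 h2))) subrr.
pose la : {measure set (measurableTypeR R) -> \bar R} := mu.
suff : (\sum_(k < n) la (J k) <= la (\bigcup_k J k))%E by [].
rewrite -measure_semi_additive//; last by apply: bigsetU_measurable => k _; exact: mJ.
apply: le_measure; rewrite ?inE//.
- by apply: bigsetU_measurable => k _; exact: mJ.
- by apply: bigcup_measurable => k _; exact: mJ.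
- by move=> x; rewrite -bigcup_mkord => -[k _ Jx]; exists k.
Qed.

Section radon_nikodym.
Variable (T : R) (p : R -> R).
Hypothesis (T0 : 0 < T) (acp : ac p) (ndp : {homo p : s t / s <= t}).

(** Radon-Nikodym theorem for the Stieltjes measure of p, restricted to ]0, T] to
    make it finite. *)
Lemma ac_nondecreasing_density : exists g : R -> R,
  mu.-integrable setT (EFin \o g) /\
  forall a b, 0 <= a -> a <= b -> b <= T ->
    \int[mu]_(s in `]a, b]) g s = p b - p a.
Proof.
pose P : cumulative R R := HB.pack p (isCumulative.Build R _ R p ndp
  (right_continuousW (ac_continuous acp))).
pose D := `]0, T]%classic : set (measurableTypeR R).
have mD : measurable D by exact: measurable_itv.
have D_fin : (lebesgue_stieltjes_measure P D < +oo)%E.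
  by rewrite lebesgue_stieltjes_itv_oc ?ltW// ltry.
pose nu := mfrestr mD D_fin.
have numu : nu `<< mu.
  apply/null_content_dominatesP => A mA A0.
  have /null_content_dominatesP dom := @ac_dominates P acp.
  apply/eqP; rewrite eq_le measure_ge0 andbT -(dom A mA A0).
  by apply: le_measure; rewrite ?inE//; exact: measurableI.
pose f := Radon_Nikodym_SigmaFinite.f nu mu.
have ffin := Radon_Nikodym_SigmaFinite.f_fin_num numu.
have fint := Radon_Nikodym_SigmaFinite.f_integrable numu.
have fE := Radon_Nikodym_SigmaFinite.f_integral numu.
exists (fine \o f).
have FE : EFin \o (fine \o f) = f.
  by apply/funext => x /=; rewrite fineK//; exact: ffin.
split; first by rewrite FE.
move=> a b a0 ab bT; rewrite /Rintegral.
rewrite (_ : (fun x => _) = f) //; last first.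
rewrite -fE//.
change (fine (lebesgue_stieltjes_measure P (`]a, b] `&` D)) = p b - p a).
rewrite setIidl ?lebesgue_stieltjes_itv_oc//.
by apply: subset_itv; rewrite bnd_simp.
Qed.
End radon_nikodym.

Lemma ac_density (T : R) (f : R -> R) : 0 < T -> ac f ->
  exists g : R -> R, mu.-integrable setT (EFin \o g) /\
    forall a b, 0 <= a -> a <= b -> b <= T ->
    \int[mu]_(s in `]a, b]) g s = f b - f a.
Proof.
move=> T0 acf; pose p t := fine (total_variation 0 (clamp T t) f).
have [acp ndp] := ac_clamped_total_variation T0 acf.
pose q t := p t - f (clamp T t).
have acfc : ac (f \o clamp T).
  move=> e e0; have [d d0 H] := acf e e0; exists d => // I u v uv tuv sd.
  apply: H => //.
  - by move=> i; exact: le_clamp.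
  - by move=> i j _ _ [x [xi xj]]; apply: tuv => //; exists x; split; [exact: clamp_oo xi|exact: clamp_oo xj].
  - by apply: le_lt_trans sd; apply: ler_sum => i _; exact: clampB.
have acq : ac q by exact: acB.
have ndq : {homo q : s t / s <= t}.
  move=> s t st; rewrite -subr_ge0.
  have -> : q t - q s = (p t - p s) - (f (clamp T t) - f (clamp T s)).
    by rewrite /q; ring.
  rewrite fine_total_variationB// subr_ge0; apply: (le_trans (ler_norm _)).
  rewrite -lee_fin fineK ?ac_total_variation_fin ?le_clamp//.
  by apply: total_variation_ge; exact: le_clamp.
have [gp [ip gpE]] := ac_nondecreasing_density T0 acp ndp.
have [gq [iq gqE]] := ac_nondecreasing_density T0 acq ndq.
exists (fun s => gp s - gq s); split; first exact: integrableB ip iq.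
move=> a b a0 ab bT; rewrite RintegralB//.
- rewrite gpE// gqE//; change (p b - p a - (q b - q a) = f b - f a).
  by rewrite /q !(@clamp_id _ T) ?(le_trans a0 ab) ?bT ?a0 ?(le_trans ab bT)//; ring.
- exact: integrableS ip.
- exact: integrableS iq.
Qed.

Lemma is_derive_shift (f F : R -> R) (c s l : R) :
  (\forall y \near s, f y = c + F y) ->
  is_derive s 1 F l -> is_derive s 1 f l.
Proof.
move=> nE dF.
have dH : is_derive s 1 (fun y => c + F y) l.
  have := @is_deriveD R R^o R^o (cst c) F s 1 0 l (is_derive_cst _ _ _) dF.
  by rewrite add0r.
apply: (near_eq_is_derive _ dH).
by apply: filterS nE => y ->.
Qed.

(** The last clause is Lebesgue's differentiation theorem for the density. *)
Lemma ac_FTC (T : R) (f : R -> R) : 0 < T -> ac f ->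
  exists g : R -> R, [/\ mu.-integrable setT (EFin \o g),
    forall a b, 0 <= a -> a <= b -> b <= T ->
    \int[mu]_(s in `[a, b]) g s = f b - f a &
    {ae mu, forall s, 0 < s < T -> is_derive s 1 f (g s)}].
Proof.
move=> T0 acf; have [g [gi gE]] := ac_density T0 acf; exists g.
have gE' a b : 0 <= a -> a <= b -> b <= T -> \int[mu]_(s in `[a, b]) g s = f b - f a.
  by move=> *; rewrite -gE// -Rintegral_itv_obnd_cbnd//; exact: integrableS gi.
split => //.
have gl : locally_integrable setT g by apply: open_integrable_locally => //; exact: openT.
have gy y : mu.-integrable [set` Interval (BLeft 0) (BRight y)] (EFin \o g).
  exact: integrableS gi.
have [F [FE HF]] : exists F : R -> R,
    (forall y, 0 <= y -> y <= T -> F y = f y - f 0) /\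
    {ae mu, forall s, 0 < s -> derivable F s 1 /\ derive1 F s = g s}.
  exists (fun y => \int[mu]_(t in `[0, y]) g t); split.
    by move=> y y0 yT; rewrite gE'.
  have := FTC1 gy gl; apply: filterS; first exact: (ae_filter_ringOfSetsType mu).
  by move=> s + s0; rewrite lte_fin; exact.
apply: filterS HF; first exact: (ae_filter_ringOfSetsType mu).
move=> s /= + /andP[s0 sT] => /(_ s0)[dF dFE].
have dFs : is_derive s 1 F (g s) by apply: DeriveDef => //; rewrite -derive1E.
apply: (@is_derive_shift _ F (f 0)) dFs.
have sI : s \in `]0, T[ by rewrite in_itv/= s0.
apply: filterS (near_in_itvoo sI) => y; rewrite in_itv/= => /andP[y0 yT].
by rewrite (FE y (ltW y0) (ltW yT)) addrC subrK.
Qed.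

End density.

(** * Kinetic energy *)
Section energy_def.
Context {R : realType}.
Implicit Types f : R -> R.

Definition disjoint_itvs (T : R) (I : finType) (u v : I -> R) :=
  (forall i, [/\ 0 <= u i, u i <= v i & v i <= T]) /\
  trivIset setT (fun i => [set` `]u i, v i[]).

(** The sum of length * (slope)^2 / 2; a degenerate interval contributes 0 because
    x / 0 = 0. *)
Definition kinetic_sum f (I : finType) (u v : I -> R) :=
  \sum_i (f (v i) - f (u i)) ^+ 2 / (2 * (v i - u i)).

Definition energy_le (T : R) f (C : R) :=
  forall (I : finType) (u v : I -> R), disjoint_itvs T u v -> kinetic_sum f u v <= C.

(** This supremum is the integral of f'^2 / 2 when f is absolutely continuous. In
    this form it is lower semicontinuous for pointwise convergence. *)
Definition energy (T : R) f := sup [set x | exists (I : finType) (u v : I -> R),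
  disjoint_itvs T u v /\ x = kinetic_sum f u v].

Lemma disjoint_itvs1 T s t : 0 <= s -> s <= t -> t <= T ->
  disjoint_itvs T (fun _ : 'I_1 => s) (fun=> t).
Proof. by move=> s0 st tT; split => // i j _ _ _; rewrite !ord1. Qed.

Lemma kinetic_sum1 f s t : kinetic_sum f (fun _ : 'I_1 => s) (fun=> t) = (f t - f s) ^+ 2 / (2 * (t - s)).
Proof. by rewrite /kinetic_sum big_ord1. Qed.

Section bounded_energy.
Variables (T : R) (f : R -> R) (C : R).
Hypotheses (T0 : 0 < T) (fC : energy_le T f C).

Lemma has_sup_kinetic_sum : has_sup [set x | exists (I : finType) (u v : I -> R),
  disjoint_itvs T u v /\ x = kinetic_sum f u v].
Proof.
split; last by exists C => _ [I [u [v [uv ->]]]]; exact: fC.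
exists (kinetic_sum f (fun _ : 'I_1 => 0) (fun=> 0)), 'I_1, (fun=> 0), (fun=> 0).
by split => //; apply: disjoint_itvs1; rewrite // ltW.
Qed.

Lemma energy_le_energy : energy_le T f (energy T f).
Proof. by move=> I u v uv; apply: (ub_le_sup has_sup_kinetic_sum.2); exists I, u, v. Qed.

Lemma ge_energy : energy T f <= C.
Proof.
apply: ge_sup; first exact: has_sup_kinetic_sum.1.
by move=> _ [I [u [v [uv ->]]]]; exact: fC.
Qed.

Lemma energy_ge0 : 0 <= energy T f.
Proof.
have /energy_le_energy := @disjoint_itvs1 T 0 0 (lexx 0) (lexx 0) (ltW T0).
by rewrite kinetic_sum1 !subrr mulr0 invr0 mulr0.
Qed.

Lemma energy_le_itv s t : 0 <= s -> s <= t -> t <= T ->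
  (f t - f s) ^+ 2 <= 2 * C * (t - s).
Proof.
move=> s0 st tT; have [ts|ts] := eqVneq t s; first by rewrite ts !subrr expr0n mulr0.
have ts0 : 0 < t - s by rewrite subr_gt0 lt_neqAle eq_sym ts.
have := fC (disjoint_itvs1 s0 st tT); rewrite kinetic_sum1 ler_pdivrMr ?mulr_gt0//.
by rewrite (_ : 2 * C * (t - s) = C * (2 * (t - s))); last by ring.
Qed.

End bounded_energy.

(** The Cauchy-Schwarz inequality bounds the increments over a family of intervals
    by the square root of its total length. *)
Lemma energy_le_ac T f C : 0 < T -> energy_le T f C ->
  (forall t, f t = f (clamp T t)) -> ac f.
Proof.
move=> T0 fC fT e e0.
have C0 : 0 <= C by exact: le_trans (energy_ge0 T0 fC) (ge_energy T0 fC).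
pose l := (C + 1) / e; have l0 : 0 < l by rewrite divr_gt0// ltr_wpDl.
exists (e / (2 * l)); first by rewrite divr_gt0// mulr_gt0.
move=> I u v uv tuv sd; pose u' := clamp T \o u; pose v' := clamp T \o v.
have uv' : disjoint_itvs T u' v'.
  split=> [i|i j _ _ [x [xi xj]]].
    by have /andP[? _] := clamp_itv T0 (u i); have /andP[_ ?] := clamp_itv T0 (v i); split; rewrite // le_clamp.
  by apply: tuv => //; exists x; split; [exact: clamp_oo xi|exact: clamp_oo xj].
have sd' : \sum_i (v' i - u' i) < e / (2 * l).
  by apply: le_lt_trans sd; apply: ler_sum => i _; exact: clampB.
(* |x| <= l h + x^2 / (4 l h) for every h > 0 *)
apply: (@le_lt_trans _ _ (\sum_i (l * (v' i - u' i) + (2 * l)^-1 * ((f (v' i) - f (u' i)) ^+ 2 / (2 * (v' i - u' i)))))).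
  apply: ler_sum => i _.
  rewrite (_ : f (v i) - f (u i) = f (v' i) - f (u' i)); last by rewrite /v' /u' /= -!fT.
  have [_ uvi _] := uv'.1 i; have [->|ne] := eqVneq (v' i) (u' i).
    by rewrite !subrr normr0 expr0n/= !mul0r !mulr0 addr0.
  have h0 : 0 < v' i - u' i by rewrite subr_gt0 lt_neqAle eq_sym ne.
  set h := v' i - u' i in h0 *; set x := f _ - _; pose y : R := `|x|; rewrite -/y.
  have -> : x ^+ 2 = y ^+ 2 by rewrite real_normK ?num_real.
  rewrite -subr_ge0 (_ : _ - y = (2 * l * h - y) ^+ 2 / (4 * l * h)).
    by apply: divr_ge0; [exact: sqr_ge0|apply: ltW; do 2?apply: mulr_gt0].
  by field; rewrite !gt_eqF.
rewrite big_split/= -!mulr_sumr.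
apply: (@lt_le_trans _ _ (l * (e / (2 * l)) + (2 * l)^-1 * C)).
  have := fC _ _ _ uv'; rewrite /kinetic_sum => fCuv.
  apply: ltr_leD; first by rewrite ltr_pM2l.
  by rewrite ler_wpM2l// invr_ge0 mulr_ge0// ltW.
have -> : l * (e / (2 * l)) = e / 2 by field; rewrite gt_eqF.
have -> : (2 * l)^-1 * C = e / 2 * (C / (C + 1)) by rewrite /l; field; rewrite !gt_eqF// ltr_wpDl.
rewrite [leRHS]splitr lerD2l ler_piMr ?divr_ge0 ?(ltW e0)//.
by rewrite ler_pdivrMr ?mul1r ?lerDl// ltr_wpDl.
Qed.

End energy_def.

(** * The distance of a vector curve to the origin *)
Section sobolev.
Context {R : realType}.
Notation mu := (@lebesgue_measure R).

Lemma cauchy_schwarz_itv (g : R -> R) (a b : R) : a <= b ->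
  mu.-integrable `[a, b] (EFin \o g) ->
  (((\int[mu]_(s in `[a, b]) g s) ^+ 2 / (2 * (b - a)))%:E <=
  \int[mu]_(s in `[a, b]) (2^-1 * g s ^+ 2)%:E)%E.
Proof.
move=> ab gi; set I := Rintegral _ _ _.
have mD : measurable (`[a, b]%classic : set (measurableTypeR R)) by exact: measurable_itv.
have mg : measurable_fun `[a, b] g by move/integrableP : gi => [/measurable_EFinP].
have mg2 : measurable_fun `[a, b] (fun s => (2^-1 * g s ^+ 2)%:E).
  by apply/measurable_EFinP/measurable_funM => //; exact: measurable_funX.
have ge0 s : (0 <= (2^-1 * g s ^+ 2)%:E)%E by rewrite lee_fin mulr_ge0// sqr_ge0.
have [ba|ba] := eqVneq b a.
  by rewrite ba subrr mulr0 invr0 mulr0 integral_ge0.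
have ba0 : 0 < b - a by rewrite subr_gt0 lt_neqAle eq_sym ba.
have [foo|] := ltP (\int[mu]_(s in `[a, b]) (2^-1 * g s ^+ 2)%:E)%E +oo%E; last first.
  by rewrite leye_eq => /eqP ->; rewrite leey.
have g2i : mu.-integrable `[a, b] (fun s => (2^-1 * g s ^+ 2)%:E).
  apply/integrableP; split => //; under eq_integral do rewrite gee0_abs//.
  exact: foo.
pose c := I / (b - a).
have ci : mu.-integrable `[a, b] (EFin \o (fun s => c * g s)).
  exact: (integrableZl mD c gi).
have di : mu.-integrable `[a, b] (EFin \o (fun=> 2^-1 * c ^+ 2)).
  apply/integrableP; split; first exact: measurable_cst.
  rewrite integral_cst//= lebesgue_measure_itv/= lte_fin -subr_gt0 ba0.
  by rewrite -EFinB -EFinM ltry.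
have : (\int[mu]_(s in `[a, b]) (c * g s - 2^-1 * c ^+ 2)%:E <= \int[mu]_(s in `[a, b]) (2^-1 * g s ^+ 2)%:E)%E.
  apply: le_integral => //; first exact: (integrableB mD ci di).
  move=> s _; rewrite lee_fin -subr_ge0.
  have -> : 2^-1 * g s ^+ 2 - (c * g s - 2^-1 * c ^+ 2) = 2^-1 * (g s - c) ^+ 2 by field.
  by rewrite mulr_ge0// sqr_ge0.
apply: le_trans; rewrite -[leRHS]fineK; last exact: (integrable_fin_num mD (integrableB mD ci di)).
rewrite lee_fin; change (I ^+ 2 / (2 * (b - a)) <= \int[mu]_(s in `[a, b]) (c * g s - 2^-1 * c ^+ 2)).
have muE : mu `[a, b] = (b - a)%:E by rewrite lebesgue_measure_itv/= lte_fin -subr_gt0 ba0.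
rewrite RintegralB// RintegralZl// Rintegral_cst//.
rewrite [X in fine X]muE/=.
rewrite -/I /c le_eqVlt; apply/orP; left; apply/eqP; field.
by rewrite gt_eqF.
Qed.

Section vector_curves.
Variables (d : nat) (T : R).
Hypothesis T0 : 0 < T.
Implicit Types h : R -> 'rV[R]_d.

Lemma enorm_ge0 (x : 'rV[R]_d) : 0 <= enorm x.
Proof. exact: sqrtr_ge0. Qed.

Lemma enorm_sqr (x : 'rV[R]_d) : enorm x ^+ 2 = \sum_i x ord0 i ^+ 2.
Proof. by rewrite sqr_sqrtr// sumr_ge0// => i _; exact: sqr_ge0. Qed.

(** Reverse triangle inequality; squares avoid the signs. *)
Lemma enorm_distance (x y : 'rV[R]_d) : (enorm x - enorm y) ^+ 2 <= enorm (x - y) ^+ 2.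
Proof.
have nx := enorm_ge0 x; have ny := enorm_ge0 y.
suff xy : \sum_i x ord0 i * y ord0 i <= enorm x * enorm y.
  rewrite sqrrB enorm_sqr (eq_bigr (fun i => x ord0 i ^+ 2 - 2 * (x ord0 i * y ord0 i) + y ord0 i ^+ 2)); last first.
    by move=> i _; rewrite !mxE; ring.
  rewrite big_split big_split/= sumrN -mulr_sumr -!enorm_sqr lerD2r lerD2l lerN2.
  by rewrite -[leRHS]mulr_natl ler_pM2l.
pose a := enorm x; pose b := enorm y.
have [a0|a0] := eqVneq a 0.
  have x0 i : x ord0 i = 0.
    have := enorm_sqr x; rewrite -/a a0 expr0n/= => /esym/eqP.
    rewrite psumr_eq0 => [/allP/(_ i (mem_index_enum i))|j _]; last exact: sqr_ge0.
    by rewrite /= sqrf_eq0 => /eqP.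
  by rewrite big1 ?mulr_ge0// => i _; rewrite x0 mul0r.
have [b0|b0] := eqVneq b 0.
  have y0 i : y ord0 i = 0.
    have := enorm_sqr y; rewrite -/b b0 expr0n/= => /esym/eqP.
    rewrite psumr_eq0 => [/allP/(_ i (mem_index_enum i))|j _]; last exact: sqr_ge0.
    by rewrite /= sqrf_eq0 => /eqP.
  by rewrite big1 ?mulr_ge0// => i _; rewrite y0 mulr0.
have a1 : 0 < a by rewrite lt_neqAle eq_sym a0 nx.
have b1 : 0 < b by rewrite lt_neqAle eq_sym b0 ny.
have : 0 <= \sum_i (b * x ord0 i - a * y ord0 i) ^+ 2 by apply: sumr_ge0 => i _; exact: sqr_ge0.
rewrite (eq_bigr (fun i => b ^+ 2 * x ord0 i ^+ 2 - 2 * a * b * (x ord0 i * y ord0 i) + a ^+ 2 * y ord0 i ^+ 2)); last first.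
  by move=> i _; ring.
rewrite big_split big_split/= sumrN -!mulr_sumr -!enorm_sqr -/a -/b => H.
rewrite -(ler_pM2l (mulr_gt0 a1 b1)).
set S := \sum_i _ in H *; nra.
Qed.

Definition row_ac h := forall i, ac (fun t => h t ord0 i).

(** The last clause compares the energy of the distance to the origin with the
    integral of |h'|^2 / 2: on each interval the increment of |h| is at most the
    norm of the integral of h'. *)
Lemma row_ac_density h : row_ac h -> exists g : 'I_d -> R -> R,
  [/\ forall i, mu.-integrable setT (EFin \o g i),
      {ae mu, forall s, 0 < s < T -> derive1 h s = \row_i g i s} &
      forall (I : finType) (u v : I -> R), disjoint_itvs T u v ->
        ((kinetic_sum (enorm \o h) u v)%:E <=
          \int[mu]_(s in `[0%R, T]) (2^-1 * \sum_i g i s ^+ 2)%:E)%E].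
Proof.
move=> ach.
have ex i := ac_FTC T0 (ach i).
pose g i := projT1 (cid (ex i)).
have gi i : mu.-integrable setT (EFin \o g i) by have [] := projT2 (cid (ex i)).
have gE i a b : 0 <= a -> a <= b -> b <= T -> \int[mu]_(s in `[a, b]) g i s = h b ord0 i - h a ord0 i.
  by have [_ + _] := projT2 (cid (ex i)); exact.
have gd i : {ae mu, forall s, 0 < s < T -> is_derive s 1 (fun t => h t ord0 i) (g i s)}.
  by have [] := projT2 (cid (ex i)).
have mg i : measurable_fun setT (g i) by have /integrableP[/measurable_EFinP] := gi i.
have mgS i D : measurable_fun D (g i) by exact: measurable_funS (mg i).
exists g; split=> //.
  have : {ae mu, forall s, forall i, 0 < s < T -> is_derive s 1 (fun t => h t ord0 i) (g i s)}.
    exact: filter_forall.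
  apply: filterS; first exact: (ae_filter_ringOfSetsType mu).
  move=> s /= H sT.
  have dh : derivable h s 1.
    apply/derivable_mxP => i j; rewrite ord1; have := H j sT => -[].
    by [].
  rewrite derive1E derive_mx//; apply/rowP => i; rewrite !mxE.
  by have := H i sT => -[].
move=> I u v [uvT tuv]; rewrite /kinetic_sum -sumEFin.
pose F i s := (2^-1 * g i s ^+ 2)%:E.
have F0 i s : (0 <= F i s)%E by rewrite lee_fin mulr_ge0// sqr_ge0.
have mF i D : measurable_fun D (F i).
  by apply/measurable_EFinP/measurable_funM => //; exact: measurable_funX.
apply: (@le_trans _ _ (\sum_k \sum_i \int[mu]_(s in `[u k, v k]) F i s)%E).
  apply: lee_sum => k _; have [u0 uv vT] := uvT k.
  apply: (@le_trans _ _ (\sum_i ((\int[mu]_(s in `[u k, v k]) g i s) ^+ 2 / (2 * (v k - u k)))%:E)%E).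
    rewrite sumEFin lee_fin -mulr_suml ler_wpM2r//.
      by rewrite invr_ge0 mulr_ge0// subr_ge0.
    apply: (le_trans (enorm_distance _ _)); rewrite enorm_sqr.
    by apply: ler_sum => i _; rewrite gE// !mxE.
  apply: lee_sum => i _; apply: cauchy_schwarz_itv => //.
  exact: integrableS (gi i).
have mF' i : measurable_fun `[0%R, T] (F i) by exact: mF.
rewrite exchange_big/=.
apply: (@le_trans _ _ (\sum_i \int[mu]_(s in `[0%R, T]) F i s)%E); last first.
  rewrite -ge0_integral_sum//.
  rewrite le_eqVlt; apply/orP; left; apply/eqP/eq_integral => s _.
  by rewrite sumEFin -mulr_sumr.
apply: lee_sum => i _.
pose J k : set (measurableTypeR R) := `]u k, v k[%classic.
rewrite (eq_bigr (fun k => \int[mu]_(s in J k) F i s)%E); last first.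
  by move=> k _; rewrite integral_itv_bndoo//; exact: mF.
rewrite -ge0_integral_bigsetU//=.
- apply: ge0_subset_integral => //.
  + by apply: bigsetU_measurable => k _; exact: measurable_itv.
  + exact: mF'.
  + rewrite -bigcup_seq => s [k _]; rewrite /J/= !in_itv/= => /andP[us sv].
    have [u0 _ vT] := uvT k.
    by rewrite (le_trans u0 (ltW us)) (le_trans (ltW sv) vT).
- by move=> k; exact: measurable_itv.
- exact: index_enum_uniq.
- exact: sub_trivIset tuv.
- exact: mF.
Qed.

End vector_curves.
End sobolev.

(** * Energy and derivative *)
Section slopes.
Context {R : realType}.
Notation mu := (@lebesgue_measure R).

(** The slopes over intervals that contain s converge to the derivative even when s
    is not an endpoint. *)
Lemma is_derive_slope (f : R -> R) (s l : R) : is_derive s 1 f l ->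
  forall e : R, 0 < e -> exists2 delta : R, 0 < delta & forall a b : R,
    a <= s -> s <= b -> a < b -> b - a < delta -> `|(f b - f a) / (b - a) - l| <= e.
Proof.
move=> /is_derive1_caratheodory[q [qE qc ql]] e e0.
have /cvgrPdist_le /(_ e e0) /nbhs_normP[d /= d0 H] := qc.
exists d => // a b as_ sb ab abd.
have H' z : `|s - z| < d -> `|f z - f s - l * (z - s)| <= e * `|z - s|.
  move=> zs; rewrite qE -mulrBl normrM ler_wpM2r//.
  by have := H z zs; rewrite ql distrC.
have ba0 : 0 < b - a by rewrite subr_gt0.
have -> : (f b - f a) / (b - a) - l =
    ((f b - f s - l * (b - s)) - (f a - f s - l * (a - s))) / (b - a).
  by field; rewrite gt_eqF.
rewrite normrM normfV (gtr0_norm ba0) ler_pdivrMr//.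
apply: (le_trans (ler_normB _ _)).
have -> : e * (b - a) = e * `|b - s| + e * `|a - s|.
  by rewrite ger0_norm ?subr_ge0// distrC ger0_norm ?subr_ge0//; ring.
apply: lerD; apply: H'.
  by rewrite distrC ger0_norm ?subr_ge0//; apply: le_lt_trans abd; rewrite lerD2l lerN2.
by rewrite ger0_norm ?subr_ge0//; apply: le_lt_trans abd; rewrite lerD2r.
Qed.

Lemma ge_limn_einf (u : (\bar R)^nat) (c : \bar R) : (forall n, (u n <= c)%E) ->
  (limn_einf u <= c)%E.
Proof.
move=> uc; rewrite limn_einf_lim; apply: lime_le; first exact: is_cvg_einfs.
by apply: nearW => n; apply: le_trans (uc n); apply: ereal_inf_lbound; exists n => /=.
Qed.

(** Fatou's lemma along the uniform subdivisions of [0, T]: the slope of f on the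
    cell of s tends to the derivative at almost every s. *)
Lemma integral_sqr_derive_le (T : R) (f g : R -> R) (C : R) : 0 < T ->
  energy_le T f C -> measurable_fun setT g ->
  {ae mu, forall s, 0 < s < T -> is_derive s 1 f (g s)} ->
  (\int[mu]_(s in `[0%R, T]) (2^-1 * g s ^+ 2)%:E <= C%:E)%E.
Proof.
move=> T0 fC mg fg.
have mg2 D : measurable_fun D (fun s => (2^-1 * g s ^+ 2)%:E).
  apply/measurable_EFinP/measurable_funM => //; apply: measurable_funX.
  exact: measurable_funS mg.
rewrite integral_itv_bndoo; last exact: mg2.
pose h n : R := T / n.+1%:R.
have h0 n : 0 < h n by rewrite divr_gt0.
pose a n k : R := k%:R * h n.
have aS n k : a n k.+1 = a n k + h n by rewrite /a -natr1 mulrDl mul1r.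
have a0 n k : 0 <= a n k by rewrite mulr_ge0// ltW.
have aT n k : (k < n.+1)%N -> a n k.+1 <= T.
  move=> kn; rewrite /a /h mulrA ler_pdivrMr// mulrC ler_pM2l// ler_nat//.
pose J n k : set (measurableTypeR R) := `[a n k, a n k.+1[%classic.
pose c n k := (f (a n k.+1) - f (a n k)) / (a n k.+1 - a n k).
pose F n s := (\sum_(k < n.+1) 2^-1 * c n k ^+ 2 * \1_(J n k) s)%:E.
have mJ n k : measurable (J n k) by exact: measurable_itv.
have JP n k s : J n k s -> forall k', J n k' s -> k' = k.
  rewrite /J/= !in_itv/= => /andP[s1 s2] k'; rewrite in_itv/= => /andP[s3 s4].
  have W x y : a n x <= s -> s < a n y.+1 -> (x <= y)%N.
    move=> h1 h2; have := le_lt_trans h1 h2.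
    by rewrite /a ltr_pM2r// ltr_nat ltnS.
  by apply/eqP; rewrite eqn_leq !W.
have mF n : measurable_fun `]0%R, T[ (F n).
  apply/measurable_EFinP; apply: measurable_sum => k.
  by apply: measurable_funM => //; apply: measurable_indic; exact: mJ.
have F0 n s : (0 <= F n s)%E.
  by rewrite lee_fin sumr_ge0// => k _; rewrite mulr_ge0// mulr_ge0// sqr_ge0.
have mD : measurable (`]0, T[%classic : set (measurableTypeR R)) by exact: measurable_itv.
have intF n : (\int[mu]_(s in `]0%R, T[) F n s <= C%:E)%E.
  rewrite /F; under eq_integral do rewrite -sumEFin.
  rewrite ge0_integral_sum//; last 2 first.
  - move=> k; apply/measurable_EFinP/measurable_funM => //; apply: measurable_indic; exact: mJ.
  - by move=> k s _; rewrite lee_fin mulr_ge0// mulr_ge0// sqr_ge0.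
  have tJ : trivIset setT (fun k : 'I_n.+1 => `]a n k, a n k.+1[%classic).
    move=> i j _ _ [s [/= si sj]]; apply/val_inj/(JP n j s).
      by move: sj; rewrite /J/= !in_itv/= => /andP[/ltW -> ->].
    by move: si; rewrite /J/= !in_itv/= => /andP[/ltW -> ->].
  have dJ : disjoint_itvs T (fun k : 'I_n.+1 => a n k) (fun k => a n k.+1).
    by split=> // k; split; rewrite ?aT// aS lerDl ltW.
  apply: (@le_trans _ _ (kinetic_sum f (fun k : 'I_n.+1 => a n k) (fun k => a n k.+1))%:E); last first.
    by rewrite lee_fin; exact: fC.
  rewrite /kinetic_sum -sumEFin; apply: lee_sum => k _.
  have ck : 0 <= 2^-1 * c n k ^+ 2 by rewrite mulr_ge0// sqr_ge0.
  rewrite (_ : (fun s => _) = (fun s => (2^-1 * c n k ^+ 2)%:E * (\1_(J n k) s)%:E)%E) //.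
  rewrite ge0_integralZl//; last by apply/measurable_EFinP; apply: measurable_indic; exact: mJ.
  rewrite integral_indic//.
  apply: (@le_trans _ _ ((2^-1 * c n k ^+ 2)%:E * (h n)%:E)%E).
    rewrite lee_wpmul2l// ?lee_fin//.
    apply: (@le_trans _ _ (mu (J n k))).
      by apply: le_measure; rewrite ?inE//; exact: measurableI.
    by rewrite lebesgue_measure_itv/= lte_fin aS ltrDl h0 -EFinB lee_fin addrAC subrr add0r.
  rewrite -EFinM lee_fin /c aS addrAC subrr add0r le_eqVlt; apply/orP; left; apply/eqP.
  by field; rewrite gt_eqF.
have Fcvg s : 0 < s < T -> is_derive s 1 f (g s) -> F ^~ s @ \oo --> (2^-1 * g s ^+ 2)%:E.
  move=> /andP[s0 sT] dfs.
  pose k n := Num.truncn (s / h n).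
  have kP n : a n (k n) <= s < a n (k n).+1.
    rewrite /a -ler_pdivlMr// -ltr_pdivrMr//.
    by apply: truncn_itv; rewrite divr_ge0// ltW.
  have kn n : (k n < n.+1)%N.
    have /andP[h1 _] := kP n; have := le_lt_trans h1 sT.
    by rewrite /a /h mulrA ltr_pdivrMr// mulrC ltr_pM2l// ltr_nat.
  have FE n : F n s = (2^-1 * c n (k n) ^+ 2)%:E.
    rewrite /F (bigD1 (Ordinal (kn n)))//= [X in _ + X]big1 ?addr0; last first.
      move=> i ik; rewrite indicE; case: (boolP (s \in J n i)); rewrite ?mulr0//.
      rewrite inE => Ji; case/negP: ik; apply/eqP/val_inj => /=.
      by apply: (JP n (k n) s) => //; rewrite /J/= in_itv/=.
    by rewrite indicE mem_set ?mulr1// /J/= in_itv/=.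
  apply/cvg_EFin; first by apply: nearW.
  rewrite (_ : fine \o _ = (fun n => 2^-1 * c n (k n) ^+ 2)); last first.
    by apply/funext => n; exact: (congr1 fine (FE n)).
  suff cc : (fun n => c n (k n)) @ \oo --> g s.
    by apply: cvgM; [exact: cvg_cst|rewrite expr2; exact: cvgM].
  apply/cvgrPdist_le => e e0; have [d d0 H] := is_derive_slope dfs e0.
  have hd : \forall n \near \oo, h n < d.
    near=> n; rewrite /h ltr_pdivrMr// mulrC -ltr_pdivrMr//.
    by apply: lt_trans (_ : n%:R < _); [near: n; exact: nbhs_infty_gtr|rewrite ltr_nat].
  apply: filterS hd => n hnd; rewrite distrC; apply: H.
  - by have /andP[] := kP n.
  - by have /andP[_ /ltW] := kP n.
  - by rewrite aS ltrDl.
  - by rewrite aS addrAC subrr add0r.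
have mF' s : (limn_einf (F ^~ s) = - limn_esup (fun n => - F n s))%E.
  by rewrite -[LHS]oppeK -limn_esupN.
apply: (@le_trans _ _ (\int[mu]_(s in `]0%R, T[) limn_einf (F ^~ s))%E).
  apply: ae_ge0_le_integral => //.
  - by move=> s _; rewrite lee_fin mulr_ge0// sqr_ge0.
  - exact: mg2.
  - move=> s _; rewrite limn_einf_lim; apply: lime_ge; first exact: is_cvg_einfs.
    by apply: nearW => n; apply: le_ereal_inf_tmp => _ [m _ <-].
  - rewrite (funext mF').
    apply: measurableT_comp => //; apply: measurable_fun_limn_esup => n.
    by apply: measurableT_comp => //; exact: mF.
  apply: filterS fg; first exact: (ae_filter_ringOfSetsType mu).
  move=> s /= fgs; rewrite in_itv/= => s0T.
  by rewrite (cvg_limn_einf_sup (Fcvg s s0T (fgs s0T))).1.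
apply: (le_trans (fatou mu mD mF (fun n s _ => F0 n s))).
exact: ge_limn_einf.
Unshelve. all: by end_near. Qed.

End slopes.

(** * The scalar potential game *)
Section scalar_game.
Context {R : realType}.
Variable T : R.
Hypothesis T0 : 0 < T.
Notation mu := (@lebesgue_measure R).
Implicit Types f : R -> R.

Definition tint (g : R -> R) : R := \int[mu]_(s in `[0, T]) g s.

Let mT : measurable (`[0, T]%classic : set (measurableTypeR R)).
Proof. exact: measurable_itv. Qed.

Lemma continuous_integrable (g : R -> R) : continuous g ->
  mu.-integrable `[0, T] (EFin \o g).
Proof.
move=> cg; apply: continuous_compact_integrable; first exact: segment_compact.
by apply: continuous_subspaceT => x; exact: cg.
Qed.

Lemma tintD (g h : R -> R) : continuous g -> continuous h ->
  tint (fun s => g s + h s) = tint g + tint h.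
Proof. by move=> cg ch; apply: RintegralD => //; exact: continuous_integrable. Qed.

Lemma tintZ (c : R) (g : R -> R) : continuous g -> tint (fun s => c * g s) = c * tint g.
Proof. by move=> cg; apply: RintegralZl => //; exact: continuous_integrable. Qed.

Lemma le_tint (g h : R -> R) : continuous g -> continuous h ->
  (forall s, 0 <= s <= T -> g s <= h s) -> tint g <= tint h.
Proof.
move=> cg ch gh; apply: le_Rintegral => //; exact: continuous_integrable.
Qed.

Lemma tint_cst (c : R) : tint (fun=> c) = T * c.
Proof.
rewrite /tint Rintegral_cst// mulrC; congr *%R.
have muT : mu `[0, T] = T%:E by rewrite lebesgue_measure_itv/= lte_fin T0 -EFinB subr0.
by rewrite [X in fine X]muT.
Qed.

Lemma norm_tint_le (g : R -> R) (M : R) : continuous g ->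
  (forall s, 0 <= s <= T -> `|g s| <= M) -> `|tint g| <= T * M.
Proof.
move=> cg gM; rewrite ler_norml -mulrN -!tint_cst; apply/andP; split.
  by apply: le_tint => //; [exact: cst_continuous|move=> s /gM; rewrite ler_norml => /andP[]].
by apply: le_tint => //; [exact: cst_continuous|move=> s /gM; rewrite ler_norml => /andP[]].
Qed.

Definition phi1 (x : R) : R := Num.sqrt (2 * x).

Lemma phi1_ge0 x : 0 <= phi1 x. Proof. exact: sqrtr_ge0. Qed.

Lemma phi1_0 : phi1 0 = 0. Proof. by rewrite /phi1 mulr0 sqrtr0. Qed.

Lemma le_phi1 x y : x <= y -> phi1 x <= phi1 y.
Proof. by move=> xy; rewrite ler_wsqrtr// ler_pM2l. Qed.

Lemma phi1_continuous : continuous phi1.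
Proof.
move=> x; apply: (@continuous_comp R R R (fun x => 2 * x) Num.sqrt); last exact: sqrt_continuous.
exact: mulrl_continuous.
Qed.

Lemma phi1_dist x y : 0 <= x -> 0 <= y -> (phi1 x - phi1 y) ^+ 2 <= 2 * `|x - y|.
Proof.
move=> x0 y0.
wlog xy : x y x0 y0 / y <= x.
  move=> W; have [|/ltW] := leP y x; first exact: W.
  by move=> xy; rewrite -sqrrN opprB distrC; exact: W.
have h := le_phi1 xy; have h0 := phi1_ge0 y.
rewrite ger0_norm ?subr_ge0// mulrBr.
have sx : phi1 x ^+ 2 = 2 * x by rewrite sqr_sqrtr// mulr_ge0.
have sy : phi1 y ^+ 2 = 2 * y by rewrite sqr_sqrtr// mulr_ge0.
rewrite -sx -sy; nra.
Qed.

(** Beyond this energy E a curve is not worth its cost: by the Cauchy-Schwarz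
    inequality the terminal gain T f(T) is at most T sqrt(2 T E) <= E. *)
Definition Emax : R := 2 * T ^+ 3.

Lemma Emax_gt0 : 0 < Emax. Proof. by rewrite mulr_gt0// exprn_gt0. Qed.

Definition admissible f := [/\ f 0 = 0, forall t, 0 <= f t,
  forall t, f t = f (clamp T t) & energy_le T f Emax].

Lemma admissible0 : admissible (fun=> 0).
Proof.
split=> // I u v _; rewrite /kinetic_sum big1 ?(ltW Emax_gt0)// => i _.
by rewrite subrr expr0n mul0r.
Qed.

Lemma admissible_holder f s t : admissible f ->
  (f t - f s) ^+ 2 <= 2 * Emax * `|t - s|.
Proof.
move=> [_ _ fT fE].
wlog st : s t / s <= t.
  move=> W; have [|/ltW] := leP s t; first exact: W.
  by move=> ts; rewrite -sqrrN opprB distrC; exact: W.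
rewrite (fT t) (fT s); have /andP[s0 _] := clamp_itv T0 s; have /andP[_ tT] := clamp_itv T0 t.
apply: (le_trans (energy_le_itv fE s0 (le_clamp T st) tT)).
rewrite ger0_norm ?subr_ge0// ler_pM2l ?mulr_gt0 ?Emax_gt0//.
exact: clampB.
Qed.

Lemma admissible_continuous f : admissible f -> continuous f.
Proof. by move=> [_ _ fT fE]; apply/ac_continuous/(energy_le_ac T0 fE). Qed.

Lemma admissible_phi1_continuous f : admissible f -> continuous (phi1 \o f).
Proof.
move=> /admissible_continuous cf x.
by apply: continuous_comp; [exact: cf|exact: phi1_continuous].
Qed.

Definition fmax : R := Num.sqrt (2 * Emax * T).

Lemma admissible_le f t : admissible f -> f t <= fmax.
Proof.
move=> af; have [f0 fge fT fE] := af.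
rewrite -(ger0_norm (fge t)) -sqrtr_sqr; apply: ler_wsqrtr.
have /andP[t0 tT] := clamp_itv T0 t.
have := energy_le_itv fE (lexx 0) t0 tT; rewrite -fT f0 !subr0 => h.
by apply: (le_trans h); rewrite ler_pM2l ?mulr_gt0 ?Emax_gt0.
Qed.

Definition phimax : R := phi1 fmax.

Lemma admissible_phi1_le f t : admissible f -> phi1 (f t) <= phimax.
Proof. by move=> af; apply/le_phi1/admissible_le. Qed.

(** Finite energy gives Hoelder exponent 1/2, and phi1 halves it. *)
Lemma phi1_equicontinuous (e : R) : 0 < e -> exists2 d : R, 0 < d &
  forall f s t, admissible f -> `|t - s| < d -> `|phi1 (f t) - phi1 (f s)| <= e.
Proof.
move=> e0; have C0 := Emax_gt0.
exists (e ^+ 4 / (8 * Emax)); first by rewrite divr_gt0 ?exprn_gt0// mulr_gt0.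
move=> f s t af tsd.
have h1 := phi1_dist (let: And4 _ h _ _ := af in h t) (let: And4 _ h _ _ := af in h s).
have h2 := admissible_holder s t af.
pose x : R := `|phi1 (f t) - phi1 (f s)|; rewrite -/x.
have x0 : 0 <= x := normr_ge0 _.
rewrite -(@ler_pXn2r _ 4)// ?nnegrE ?(ltW e0)//.
have -> : x ^+ 4 = ((phi1 (f t) - phi1 (f s)) ^+ 2) ^+ 2.
  by rewrite (_ : (phi1 (f t) - phi1 (f s)) ^+ 2 = x ^+ 2) -?exprM// /x real_normK ?num_real.
apply: (@le_trans _ _ ((2 * `|f t - f s|) ^+ 2)).
  by rewrite ler_pXn2r// ?nnegrE ?sqr_ge0// mulr_ge0.
rewrite exprMn real_normK ?num_real//.
apply: (@le_trans _ _ (2 ^+ 2 * (2 * Emax * `|t - s|))).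
  by rewrite ler_pM2l// exprn_gt0.
have -> : e ^+ 4 = 2 ^+ 2 * (2 * Emax * (e ^+ 4 / (8 * Emax))).
  by field; rewrite gt_eqF.
by rewrite ler_pM2l ?exprn_gt0// ler_pM2l ?mulr_gt0// ltW.
Qed.

Lemma mulr_continuous (g h : R -> R) : continuous g -> continuous h ->
  continuous (fun s => g s * h s).
Proof. by move=> cg ch s; exact: (@continuousM _ _ g h s (cg s) (ch s)). Qed.

Definition penergy f : R := energy T f - T * f T.

(** The cost of a curve on a half-line when the mean of phi at time s is a s. *)
Definition cost1 (a : R -> R) f : R := penergy f + tint (fun s => a s * phi1 (f s)).

Lemma fmax_ge0 : 0 <= fmax. Proof. exact: sqrtr_ge0. Qed.

Lemma phimax_ge0 : 0 <= phimax. Proof. exact: phi1_ge0. Qed.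

Lemma penergy_bounds f : admissible f -> - (T * fmax) <= penergy f <= Emax.
Proof.
move=> af; have [f0 fge fT fE] := af; rewrite /penergy.
have h1 := energy_ge0 T0 fE; have h2 := ge_energy T0 fE.
have h3 := admissible_le T af; have h4 := fge T.
apply/andP; split.
  by rewrite -[leLHS]add0r lerD// lerN2 ler_pM2l.
by apply: le_trans h2; rewrite gerBl mulr_ge0// ltW.
Qed.

(** Finitely additive probabilities on the admissible curves. Unlike laws, they
    integrate all functionals, so that limits need no measurability. The clause
    mean_tint is Fubini's theorem, which finite additivity does not imply. *)
Record mean (L : ((R -> R) -> R) -> R) : Prop := Mean {
  meanD : forall F G, L (fun f => F f + G f) = L F + L G;
  meanZ : forall c F, L (fun f => c * F f) = c * L F;
  le_mean : forall F G, (forall f, admissible f -> F f <= G f) -> L F <= L G;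
  mean1 : L (fun=> 1) = 1;
  mean_tint : forall b : R -> R, continuous b ->
    L (fun f => tint (fun s => b s * phi1 (f s))) =
    tint (fun s => b s * L (fun f => phi1 (f s)))
}.

Definition profile (L : ((R -> R) -> R) -> R) (s : R) := L (fun f => phi1 (f s)).

Section mean_theory.
Variable L : ((R -> R) -> R) -> R.
Hypothesis mL : mean L.

Lemma mean_cst c : L (fun=> c) = c.
Proof.
rewrite -[in RHS](mulr1 c) -[in RHS](mean1 mL) -(meanZ mL).
by congr L; apply/funext => f; rewrite mulr1.
Qed.

Lemma mean_ge c F : (forall f, admissible f -> c <= F f) -> c <= L F.
Proof. by move=> cF; rewrite -(mean_cst c); exact: (le_mean mL). Qed.

Lemma mean_le c F : (forall f, admissible f -> F f <= c) -> L F <= c.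
Proof. by move=> cF; rewrite -(mean_cst c); exact: (le_mean mL). Qed.

Lemma meanB F G : L (fun f => F f - G f) = L F - L G.
Proof.
rewrite (_ : (fun f => _) = (fun f => F f + (-1) * G f)).
  by rewrite (meanD mL) (meanZ mL) mulN1r.
by apply/funext => f; rewrite mulN1r.
Qed.

Lemma norm_mean_le c F : (forall f, admissible f -> `|F f| <= c) -> `|L F| <= c.
Proof.
move=> Fc; rewrite ler_norml; apply/andP; split; [apply: mean_ge|apply: mean_le];
  by move=> f /Fc; rewrite ler_norml => /andP[].
Qed.

Lemma profile_bounds s : 0 <= profile L s <= phimax.
Proof.
apply/andP; split; first by apply: mean_ge => f _; exact: phi1_ge0.
by apply: mean_le => f; exact: admissible_phi1_le.
Qed.

Lemma profile_equicontinuous (e d : R) :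
  (forall f s t, admissible f -> `|t - s| < d -> `|phi1 (f t) - phi1 (f s)| <= e) ->
  forall s t, `|t - s| < d -> `|profile L t - profile L s| <= e.
Proof.
move=> H s t ts; rewrite /profile -meanB; apply: norm_mean_le => f af.
exact: H.
Qed.

Lemma equicontinuous_continuous (a : R -> R) :
  (forall e, 0 < e -> exists2 d : R, 0 < d & forall s t, `|t - s| < d -> `|a t - a s| <= e) ->
  continuous a.
Proof.
move=> H s; apply/cvgrPdist_le => e e0; have [d d0 Hd] := H e e0.
apply/nbhs_normP; exists d => //= t st.
by rewrite distrC; apply: Hd; rewrite distrC.
Qed.

Lemma profile_continuous : continuous (profile L).
Proof.
apply: equicontinuous_continuous => e e0.
have [d d0 H] := phi1_equicontinuous e0; exists d => //.
exact: profile_equicontinuous.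
Qed.

End mean_theory.

Lemma mean_dirac f : admissible f -> mean (fun F => F f).
Proof. by move=> af; split => // F G; exact. Qed.

Lemma mean_mix L f (t : R) : mean L -> admissible f -> 0 <= t <= 1 ->
  mean (fun F => (1 - t) * L F + t * F f).
Proof.
move=> mL af /andP[t0 t1]; split.
- by move=> F G; rewrite (meanD mL); ring.
- by move=> c F; rewrite (meanZ mL); ring.
- move=> F G FG; apply: lerD; last by rewrite ler_wpM2l// FG.
  by rewrite ler_wpM2l ?subr_ge0// (le_mean mL).
- by rewrite (mean1 mL); ring.
- move=> b cb; rewrite (mean_tint mL)//.
  have c1 : continuous (fun s => b s * L (fun g => phi1 (g s))).
    by apply: mulr_continuous; [exact: cb|exact: (profile_continuous mL)].
  have c2 : continuous (fun s => b s * phi1 (f s)).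
    by apply: mulr_continuous; [exact: cb|exact: (admissible_phi1_continuous af)].
  rewrite -(tintZ (1 - t) c1) -(tintZ t c2) -tintD.
  + by congr tint; apply/funext => s; ring.
  + by apply: mulr_continuous; [exact: cst_continuous|exact: c1].
  + by apply: mulr_continuous; [exact: cst_continuous|exact: c2].
Qed.

(** A convex functional whose derivative at L in the direction of f is cost1 of the
    profile of L, up to a constant. *)
Definition potential L : R := L penergy + 2^-1 * tint (fun s => profile L s ^+ 2).

Lemma continuous_sqr (a : R -> R) : continuous a -> continuous (fun s => a s ^+ 2).
Proof. move=> ca; rewrite (_ : (fun s => _) = (fun s => a s * a s)); first exact: mulr_continuous.
by apply/funext => s; rewrite expr2. Qed.

Lemma potential_ge L : mean L -> - (T * fmax) <= potential L.
Proof.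
move=> mL; rewrite /potential -[leLHS]addr0; apply: lerD.
  by apply: (mean_ge mL) => f /penergy_bounds/andP[].
rewrite mulr_ge0//; have -> : 0 = tint (fun=> 0) by rewrite tint_cst mulr0.
apply: le_tint; [exact: cst_continuous|exact/continuous_sqr/profile_continuous|].
by move=> s _; exact: sqr_ge0.
Qed.

Definition slack : R := 1 + 2^-1 * (T * phimax ^+ 2).

(** Second order expansion along the segment from L to the Dirac mass at f. *)
Lemma potential_mix L f (t : R) : mean L -> admissible f -> 0 <= t <= 1 ->
  potential (fun F => (1 - t) * L F + t * F f) <= potential L +
    t * (cost1 (profile L) f - (L penergy + tint (fun s => profile L s ^+ 2))) +
    t ^+ 2 * (2^-1 * (T * phimax ^+ 2)).
Proof.
move=> mL af t01; rewrite /potential /cost1.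
have cL := profile_continuous mL; set a := profile L in cL *.
have cf := admissible_phi1_continuous af; pose p := phi1 \o f.
rewrite -/p in cf.
have cap : continuous (fun s => a s * p s) by apply: mulr_continuous; [exact: cL|exact: cf].
have caa := continuous_sqr cL.
have cpa : continuous (fun s => (p s - a s) ^+ 2).
  by apply: continuous_sqr => s; apply: continuousB; [exact: cf|exact: cL].
have cZ (c : R) (g : R -> R) : continuous g -> continuous (fun s => c * g s).
  by move=> cg; apply: mulr_continuous; [exact: cst_continuous|exact: cg].
have cD (g h : R -> R) : continuous g -> continuous h -> continuous (fun s => g s + h s).
  by move=> cg ch s; apply: continuousD; [exact: cg|exact: ch].
have -> : tint (fun s => profile (fun F => (1 - t) * L F + t * F f) s ^+ 2) =
    tint (fun s => a s ^+ 2) + (t * 2) * tint (fun s => a s * p s) +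
    (- (t * 2)) * tint (fun s => a s ^+ 2) + t ^+ 2 * tint (fun s => (p s - a s) ^+ 2).
  have c1 := cZ (t * 2) _ cap; have c2 := cZ (- (t * 2)) _ caa; have c3 := cZ (t ^+ 2) _ cpa.
  have c4 := cD _ _ caa c1; have c5 := cD _ _ c4 c2.
  rewrite -!tintZ// -(tintD caa c1) -(tintD c4 c2) -(tintD c5 c3).
  by congr tint; apply/funext => s; rewrite /profile /a /p /= /profile; ring.
have h : tint (fun s => (p s - a s) ^+ 2) <= T * phimax ^+ 2.
  rewrite -tint_cst; apply: le_tint => //; first exact: cst_continuous.
  move=> s _; have /andP[a0 aM] := profile_bounds mL s; rewrite -/a in a0 aM.
  have p0 : 0 <= p s := phi1_ge0 _; have pM : p s <= phimax := admissible_phi1_le s af.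
  by rewrite -[leLHS]real_normK ?num_real// ler_pXn2r ?nnegrE ?phimax_ge0// ler_norml; apply/andP; split; lra.
have : t ^+ 2 * tint (fun s => (p s - a s) ^+ 2) <= t ^+ 2 * (T * phimax ^+ 2).
  by rewrite ler_wpM2l// sqr_ge0.
set X := t ^+ 2 * tint _; set Y := t ^+ 2 * (T * _); set Z := t ^+ 2 * _.
have -> : Z = 2^-1 * Y by rewrite /Z /Y; ring.
move=> XY; change (tint (fun s => a s * phi1 (f s))) with (tint (fun s => a s * p s)).
lra.
Qed.

(** First order condition at an approximate minimiser of the potential: its mean
    cost, the first two terms, is nearly minimal. *)
Lemma approximate_equilibrium (n : nat) : exists L, mean L /\
  forall f, admissible f ->
    L penergy + tint (fun s => profile L s ^+ 2) - slack / n.+1%:R <= cost1 (profile L) f.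
Proof.
pose S := [set potential L | L in mean].
have S0 : S !=set0 by exists (potential (fun F => F (fun=> 0))), (fun F => F (fun=> 0)) => //; exact/mean_dirac/admissible0.
have Slb : has_lbound S by exists (- (T * fmax)) => _ [L mL <-]; exact: potential_ge.
pose t : R := n.+1%:R^-1.
have t0 : 0 < t by rewrite invr_gt0.
have t1 : t <= 1 by rewrite invf_le1// ler1n.
(* a mixture of weight t gains t times the defect and loses t^2: the infimum is
   approached within t^2 *)
have [_ [L mL <-] Lt] := inf_adherent (exprn_gt0 2 t0) (conj S0 Slb).
exists L; split=> // f af.
have t01 : 0 <= t <= 1 by rewrite t1 ltW.
have := potential_mix mL af t01.
have : inf S <= potential (fun F => (1 - t) * L F + t * F f).
  by apply: ge_inf => //; exists (fun F => (1 - t) * L F + t * F f) => //; exact: mean_mix.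
rewrite -/t /slack -/(t) => h1 h2.
have h3 := le_lt_trans (le_trans h1 h2) _.
rewrite -subr_ge0; set D := cost1 _ _ in h2 *; set E := _ + tint _ in h2 *.
rewrite -(pmulr_rge0 _ t0).
have -> : t * (D - (E - (1 + 2^-1 * (T * phimax ^+ 2)) * t)) =
   t * (D - E) + t ^+ 2 * (2^-1 * (T * phimax ^+ 2)) + t ^+ 2 by ring.
lra.
Qed.

Lemma ultrafilter_nat : exists U : set_system nat, UltraFilter U /\ (\oo `<=` U).
Proof. exact: ultraFilterLemma. Qed.

Lemma ultra_cvg (U : set_system nat) (u : nat -> R) (B : R) : UltraFilter U ->
  (forall n, `|u n| <= B) -> exists l : R, u @ U --> l.
Proof.
move=> UU uB.
have PU : ProperFilter U := @ultra_proper _ U UU.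
have [|l [_ ul]] := @segment_compact R (- B) B (u @ U) _.
  by apply: (@filterS _ U _ setT); [move=> n _ /=; rewrite in_itv/= -ler_norml|exact: filterT].
exists l => A lA; have [//|uA] := in_ultra_setVsetC (u @^-1` A) UU.
have [x [/= nAx Ax]] := ul (~` A) A uA lA.
by case: nAx.
Qed.

(** Equicontinuity reduces uniform convergence to finitely many times. *)
Lemma uniform_ultralimit (U : set_system nat) (u : nat -> R -> R) (a : R -> R) :
  UltraFilter U ->
  (forall e, 0 < e -> exists2 d : R, 0 < d &
    forall n s t, `|t - s| < d -> `|u n t - u n s| <= e) ->
  (forall e, 0 < e -> exists2 d : R, 0 < d &
    forall s t, `|t - s| < d -> `|a t - a s| <= e) ->
  (forall s, u ^~ s @ U --> a s) ->
  forall e : R, 0 < e -> \forall n \near U, forall s, 0 <= s <= T -> `|u n s - a s| <= e.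
Proof.
move=> UU eu ea ua e e0; have e30 : 0 < e / 3 by rewrite divr_gt0.
have [d1 d10 H1] := eu _ e30; have [d2 d20 H2] := ea _ e30.
pose d := Num.min d1 d2; have d0 : 0 < d by rewrite lt_min d10.
pose N := (Num.bound (T / d)).+1; pose h := T / N%:R.
have h0 : 0 < h by rewrite divr_gt0.
have hd : h < d.
  rewrite ltr_pdivrMr// mulrC -ltr_pdivrMr//.
  apply: (lt_trans (archi_boundP _)); last by rewrite ltr_nat.
  by rewrite divr_ge0// ltW.
have PU : ProperFilter U := @ultra_proper _ U UU.
have : \forall n \near U, forall j : 'I_N.+1, `|u n (j%:R * h) - a (j%:R * h)| <= e / 3.
  apply: filter_forall => j.
  have /cvgrPdist_le /(_ _ e30) := ua (j%:R * h).
  by apply: filterS => n; rewrite distrC.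
apply: filterS => n Hn s /andP[s0 sT].
pose j := Num.truncn (s / h).
have /andP[js sj] : j%:R * h <= s < j.+1%:R * h.
  rewrite -ler_pdivlMr// -ltr_pdivrMr//; apply: truncn_itv.
  by rewrite divr_ge0// ltW.
have jN : (j < N.+1)%N.
  have := le_trans js sT; rewrite /h mulrA ler_pdivrMr// mulrC ler_pM2l// ler_nat.
  by rewrite ltnS.
have jsd : `|s - j%:R * h| < d.
  rewrite ger0_norm ?subr_ge0// ltrBlDr; apply: (lt_le_trans sj).
  by rewrite -natr1 mulrDl mul1r addrC lerD2r ltW.
have hj := Hn (Ordinal jN); rewrite /= in hj.
have h1 := H1 n (j%:R * h) s (lt_le_trans jsd _).
have h2 := H2 (j%:R * h) s (lt_le_trans jsd _).
have {}h1 : `|u n s - u n (j%:R * h)| <= e / 3 by apply: h1; rewrite ge_min lexx.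
have {}h2 : `|a s - a (j%:R * h)| <= e / 3 by apply: h2; rewrite ge_min lexx orbT.
have -> : u n s - a s = (u n s - u n (j%:R * h)) + (u n (j%:R * h) - a (j%:R * h)) - (a s - a (j%:R * h)) by ring.
apply: (le_trans (ler_normB _ _)).
have : `|u n s - u n (j%:R * h) + (u n (j%:R * h) - a (j%:R * h))| <= e / 3 + e / 3.
  by apply: (le_trans (ler_normD _ _)); exact: lerD.
lra.
Qed.

(** V is the limit of the mean costs of the approximate equilibria. *)
Lemma cost_equilibrium : exists (U : set_system nat) (L : nat -> ((R -> R) -> R) -> R)
    (a : R -> R) (V : R), [/\ UltraFilter U, forall n, mean (L n), continuous a & forall s, 0 <= a s <= phimax] /\
  [/\ (forall s, (fun n => profile (L n) s) @ U --> a s),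
    (forall f, admissible f -> V <= cost1 a f) & ((fun n => L n (cost1 a)) @ U --> V)].
Proof.
have [U [UU ooU]] := ultrafilter_nat.
have PU : ProperFilter U := @ultra_proper _ U UU.
pose L n := projT1 (cid (approximate_equilibrium n)).
have mL n : mean (L n) by have [] := projT2 (cid (approximate_equilibrium n)).
have hL n f : admissible f -> L n penergy + tint (fun s => profile (L n) s ^+ 2) - slack / n.+1%:R
    <= cost1 (profile (L n)) f.
  by have [_] := projT2 (cid (approximate_equilibrium n)); exact.
have exa s : exists l : R, (fun n => profile (L n) s) @ U --> l.
  apply: (@ultra_cvg U _ phimax) => // n; have /andP[p0 p1] := profile_bounds (mL n) s.
  by rewrite ger0_norm.
pose a s := projT1 (cid (exa s)).
have aP s : (fun n => profile (L n) s) @ U --> a s := projT2 (cid (exa s)).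
have eu (e : R) : 0 < e -> exists2 d : R, 0 < d &
    forall n s t, `|t - s| < d -> `|profile (L n) t - profile (L n) s| <= e.
  move=> e0; have [d d0 H] := phi1_equicontinuous e0; exists d => // n.
  by apply: profile_equicontinuous; [exact: mL|].
have ea (e : R) : 0 < e -> exists2 d : R, 0 < d &
    forall s t, `|t - s| < d -> `|a t - a s| <= e.
  move=> e0; have [d d0 H] := eu e e0; exists d => // s t st.
  have h : (fun n => profile (L n) t - profile (L n) s) @ U --> a t - a s by exact: cvgB.
  apply: (ler_cvg_to (cvg_norm h) (cvg_cst e)).
  by apply: nearW => n /=; exact: H.
have ca : continuous a := equicontinuous_continuous ea.
have cL n : continuous (profile (L n)) := profile_continuous (mL n).
have aB s : 0 <= a s <= phimax.
  apply/andP; split.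
    apply: (ler_cvg_to (cvg_cst 0) (aP s)); apply: nearW => n.
    by have /andP[] := profile_bounds (mL n) s.
  apply: (ler_cvg_to (aP s) (cvg_cst phimax)); apply: nearW => n.
  by have /andP[] := profile_bounds (mL n) s.
have unif := uniform_ultralimit UU eu ea aP.
have tcvg (q : R -> R) (M : R) (v : nat -> R -> R) : continuous q -> (forall n, continuous (v n)) ->
    (forall n s, 0 <= s <= T -> `|v n s - q s| <= M * `|profile (L n) s - a s|) -> 0 < M ->
    (fun n => tint (v n)) @ U --> tint q.
  move=> cq cv vq M0; apply/cvgrPdist_le => e e0.
  have e1 : 0 < e / (T * M) by rewrite divr_gt0// mulr_gt0.
  apply: filterS (unif _ e1) => n Hn.
  have cB : continuous (fun s => v n s - q s).
    by move=> s; exact: (@continuousB _ _ _ (v n) q s (cv n s) (cq s)).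
  have -> : tint q - tint (v n) = - tint (fun s => v n s - q s).
    have -> : tint (v n) = tint (fun s => (v n s - q s) + q s).
      by congr tint; apply/funext => s; rewrite subrK.
    by rewrite tintD//; ring.
  rewrite normrN.
  have -> : e = T * (M * (e / (T * M))) by field; rewrite !gt_eqF.
  apply: norm_tint_le => // s sT; apply: (le_trans (vq n s sT)).
  by rewrite ler_pM2l// Hn.
have M0 : 0 < phimax + 1 by rewrite ltr_wpDl ?phimax_ge0.
have [E EP] : exists l : R, (fun n => L n penergy) @ U --> l.
  apply: (@ultra_cvg U _ (T * fmax + Emax)) => // n.
  apply: (norm_mean_le (mL n)) => f /penergy_bounds/andP[h1 h2].
  have h3 := Emax_gt0; have h4 : 0 <= T * fmax by rewrite mulr_ge0 ?fmax_ge0// ltW.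
  by rewrite ler_norml; apply/andP; split; lra.
have sqcvg : (fun n => tint (fun s => profile (L n) s ^+ 2)) @ U --> tint (fun s => a s ^+ 2).
  apply: (tcvg _ (2 * (phimax + 1))).
  - exact: continuous_sqr.
  - by move=> n; exact: continuous_sqr.
  - move=> n s _; rewrite subr_sqr mulrC normrM ler_wpM2r//.
    have /andP[h1 h2] := aB s; have /andP[h3 h4] := profile_bounds (mL n) s.
    by rewrite ger0_norm ?addr_ge0//; lra.
  - by rewrite mulr_gt0.
have prcvg : (fun n => tint (fun s => a s * profile (L n) s)) @ U --> tint (fun s => a s ^+ 2).
  apply: (tcvg _ (phimax + 1)) => //.
  - exact: continuous_sqr.
  - by move=> n; exact: mulr_continuous.
  - move=> n s _; rewrite expr2 -mulrBr normrM ler_wpM2r//.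
    by have /andP[h1 h2] := aB s; rewrite ger0_norm//; lra.
exists U, L, a, (E + tint (fun s => a s ^+ 2)); split; split => //.
- move=> f af; rewrite /cost1.
  have cf := admissible_phi1_continuous af.
  have fcvg : (fun n => tint (fun s => profile (L n) s * phi1 (f s))) @ U --> tint (fun s => a s * phi1 (f s)).
    apply: (tcvg _ (phimax + 1)) => //.
    + exact: (mulr_continuous ca cf).
    + by move=> n; exact: (mulr_continuous (cL n) cf).
    + move=> n s _; rewrite -mulrBl normrM mulrC ler_wpM2r//.
      by rewrite ger0_norm ?phi1_ge0//; have := admissible_phi1_le s af; lra.
  have sl : (fun n : nat => slack / n.+1%:R) @ U --> (0 : R).
    have h : (fun n : nat => slack / n.+1%:R) @ \oo --> slack * 0.
      by apply: cvgM; [exact: cvg_cst|exact: cvg_harmonic].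
    by rewrite mulr0 in h; move=> A /h; exact: ooU.
  have lcvg : (fun n => L n penergy + tint (fun s => profile (L n) s ^+ 2) - slack / n.+1%:R) @ U
      --> E + tint (fun s => a s ^+ 2).
    by rewrite -[X in _ --> X]subr0; apply: cvgB => //; exact: cvgD.
  have rcvg : (fun n => penergy f + tint (fun s => profile (L n) s * phi1 (f s))) @ U
      --> penergy f + tint (fun s => a s * phi1 (f s)).
    by apply: cvgD => //; exact: cvg_cst.
  apply: (ler_cvg_to lcvg rcvg).
  by apply: nearW => n; exact: hL.
- have -> : (fun n => L n (cost1 a)) = (fun n => L n penergy + tint (fun s => a s * profile (L n) s)).
    by apply/funext => n; rewrite /cost1 (meanD (mL n)) (mean_tint (mL n)).
  exact: cvgD.
Qed.

End scalar_game.

(** * Realising the limit by a random curve *)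
Section random_curve.
Context {R : realType}.
Variable T : R.
Hypothesis T0 : 0 < T.
Notation mu := (@lebesgue_measure R).
Implicit Types f : R -> R.

Notation admissible := (admissible T).

(** The Arzela-Ascoli theorem: a curve is determined up to e by its values on a fine
    grid, rounded to multiples of e / 3. *)
Lemma totally_bounded (e : R) : 0 < e -> exists (N : nat) (c : (R -> R) -> nat),
  (forall f, (c f < N)%N) /\
  forall f g, admissible f -> admissible g -> c f = c g -> forall t, `|f t - g t| <= e.
Proof.
move=> e0; have e30 : 0 < e / 3 by rewrite divr_gt0.
pose d := (e / 3) ^+ 2 / (2 * Emax T).
have d0 : 0 < d by rewrite divr_gt0 ?exprn_gt0// mulr_gt0// Emax_gt0.
pose n := (Num.bound (T / d)).+1; pose h := T / n%:R.
have h0 : 0 < h by rewrite divr_gt0.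
have hd : h < d.
  rewrite ltr_pdivrMr// mulrC -ltr_pdivrMr//.
  apply: (lt_trans (archi_boundP _)); last by rewrite ltr_nat.
  by rewrite divr_ge0// ltW.
pose B := Num.truncn (fmax T / (e / 3)).
pose q f (j : nat) := Num.truncn (f (j%:R * h) / (e / 3)).
pose w f := [ffun j : 'I_n.+1 => inord (q f j) : 'I_B.+1].
exists #|{ffun 'I_n.+1 -> 'I_B.+1}|, (fun f => nat_of_ord (enum_rank (w f))); split.
  by move=> f; exact: ltn_ord.
have qB f j : admissible f -> (q f j < B.+1)%N.
  move=> af; rewrite ltnS /q /B; apply: le_truncn.
  by rewrite ler_pM2r ?invr_gt0//; exact: admissible_le.
have near_grid f s j : admissible f -> `|s - j%:R * h| < d -> `|f s - f (j%:R * h)| <= e / 3.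
  move=> af sd; rewrite -(@ler_pXn2r _ 2)// ?nnegrE ?(ltW e30)//.
  rewrite real_normK ?num_real//; apply: (le_trans (admissible_holder T0 _ _ af)).
  have -> : (e / 3) ^+ 2 = 2 * Emax T * d.
    by rewrite /d; field; rewrite gt_eqF// Emax_gt0.
  by rewrite ler_pM2l ?mulr_gt0 ?Emax_gt0// ltW.
move=> f g af ag /ord_inj/enum_rank_inj/ffunP wfg t.
have [_ _ fT _] := af; have [_ _ gT _] := ag; rewrite (fT t) (gT t).
have /andP[s0 sT] := clamp_itv T0 t; set s := clamp T t in s0 sT *.
pose j := Num.truncn (s / h).
have /andP[js sj] : j%:R * h <= s < j.+1%:R * h.
  rewrite -ler_pdivlMr// -ltr_pdivrMr//; apply: truncn_itv.
  by rewrite divr_ge0// ltW.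
have jn : (j < n.+1)%N.
  have := le_trans js sT; rewrite /h mulrA ler_pdivrMr// mulrC ler_pM2l// ler_nat.
  by rewrite ltnS.
have jsd : `|s - j%:R * h| < d.
  rewrite ger0_norm ?subr_ge0// ltrBlDr; apply: (lt_le_trans sj).
  by rewrite -natr1 mulrDl mul1r addrC lerD2r ltW.
have := wfg (Ordinal jn); rewrite !ffunE /= => /(congr1 val); rewrite /= !inordK ?qB// => qfg.
have tr x : 0 <= x -> (Num.truncn (x / (e / 3)))%:R * (e / 3) <= x < (Num.truncn (x / (e / 3)))%:R * (e / 3) + e / 3.
  move=> x0; rewrite -[X in _ < _ + X]mul1r -mulrDl natr1 -ler_pdivlMr// -ltr_pdivrMr//; apply: truncn_itv.
  by rewrite divr_ge0// ltW.
have [_ f0 _ _] := af; have [_ g0 _ _] := ag.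
have := tr _ (f0 (j%:R * h)); have := tr _ (g0 (j%:R * h)).
rewrite -[Num.truncn (f _ / _)]/(q f j) -[Num.truncn (g _ / _)]/(q g j) qfg.
set Q := _%:R * _ => /andP[g1 g2] /andP[f1 f2].
have fg : `|f (j%:R * h) - g (j%:R * h)| <= e / 3 by rewrite ler_norml; apply/andP; split; lra.
have hf := near_grid f s j af jsd; have hg := near_grid g s j ag jsd.
have -> : f s - g s = (f s - f (j%:R * h)) + (f (j%:R * h) - g (j%:R * h)) - (g s - g (j%:R * h)) by ring.
apply: (le_trans (ler_normB _ _)).
have : `|f s - f (j%:R * h) + (f (j%:R * h) - g (j%:R * h))| <= e / 3 + e / 3.
  by apply: (le_trans (ler_normD _ _)); exact: lerD.
lra.
Qed.

Section codes.

Definition mesh (k : nat) : R := k.+1%:R^-1.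

Lemma mesh_gt0 k : 0 < mesh k. Proof. by rewrite invr_gt0. Qed.

Definition digits k : nat := projT1 (cid (totally_bounded (mesh_gt0 k))).

Lemma digit_ex k : exists c : (R -> R) -> nat, (forall f, (c f < digits k)%N) /\
  forall f g, admissible f -> admissible g -> c f = c g -> forall t, `|f t - g t| <= mesh k.
Proof. exact: projT2 (cid (totally_bounded (mesh_gt0 k))). Qed.

Definition digit k : (R -> R) -> nat := projT1 (cid (digit_ex k)).

Lemma ltn_digit k f : (digit k f < digits k)%N.
Proof. by have [h _] := projT2 (cid (digit_ex k)); exact: h. Qed.

Lemma digit_close k f g : admissible f -> admissible g -> digit k f = digit k g ->
  forall t, `|f t - g t| <= mesh k.
Proof. by have [_ h] := projT2 (cid (digit_ex k)); exact: h. Qed.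

Lemma digits_gt0 k : (0 < digits k)%N.
Proof. exact: leq_ltn_trans (ltn_digit k (fun=> 0)). Qed.

(** The digits up to level k, in mixed radix: the cell of f at level k.+1 is the
    digit-th part of its cell at level k, and the order of the codes refines from
    one level to the next. *)
Fixpoint code k f : nat := if k is k'.+1 then (code k' f * digits k' + digit k' f)%N else 0%N.

Fixpoint codes k : nat := if k is k'.+1 then (codes k' * digits k')%N else 1%N.

Lemma code_div k f : (code k.+1 f %/ digits k)%N = code k f.
Proof. by rewrite /= divnMDl ?digits_gt0// divn_small ?addn0// ltn_digit. Qed.

Lemma ltn_code k f : (code k f < codes k)%N.
Proof.
elim: k => [//|k IH]; rewrite -ltn_divLR ?digits_gt0//; last by rewrite code_div.
Qed.

Lemma code_close k f g : admissible f -> admissible g -> code k.+1 f = code k.+1 g ->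
  forall t, `|f t - g t| <= mesh k.
Proof.
move=> af ag fg; apply: digit_close => //.
have := congr1 (fun m => m %% digits k)%N fg.
by rewrite /= !modnMDl !modn_small ?ltn_digit.
Qed.

End codes.

Lemma mesh_cvg : mesh @ \oo --> (0 : R).
Proof. exact: cvg_harmonic. Qed.

Lemma cvg_mesh_close (u : nat -> R) (l : R) : (forall k, `|u k - l| <= mesh k) -> u @ \oo --> l.
Proof.
move=> ul; apply/cvgrPdist_le => e e0.
have : \forall k \near \oo, mesh k <= e by exact: (cvgr_le 0 mesh_cvg).
by apply: filterS => k; apply: le_trans; rewrite distrC.
Qed.

Lemma kinetic_sum_cvg (y : nat -> R -> R) (x : R -> R) (I : finType) (u v : I -> R) :
  (forall t, (fun k => y k t) @ \oo --> x t) ->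
  (fun k => kinetic_sum (y k) u v) @ \oo --> kinetic_sum x u v.
Proof.
move=> yx; rewrite /kinetic_sum; elim: (index_enum I) => [|i r IH].
  rewrite big_nil (_ : (fun k => _) = cst 0); first exact: cvg_cst.
  by apply/funext => k; rewrite big_nil.
rewrite big_cons (_ : (fun k => _) = (fun k => (y k (v i) - y k (u i)) ^+ 2 / (2 * (v i - u i)) +
  \sum_(j <- r) (y k (v j) - y k (u j)) ^+ 2 / (2 * (v j - u j)))); last first.
  by apply/funext => k; rewrite big_cons.
apply: cvgD => //; apply: cvgM; last exact: cvg_cst.
rewrite expr2 (_ : (fun k => _) = (fun k => (y k (v i) - y k (u i)) * (y k (v i) - y k (u i)))); last first.
  by apply/funext => k; rewrite expr2.
by apply: cvgM; apply: cvgB; exact: yx.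
Qed.

Lemma phi1_close (x y e : R) : 0 <= x -> 0 <= y -> `|x - y| <= e -> `|phi1 x - phi1 y| <= phi1 e.
Proof.
move=> x0 y0 xy; have e0 : 0 <= e by exact: le_trans xy.
rewrite -(@ler_pXn2r _ 2)// ?nnegrE ?phi1_ge0// real_normK ?num_real//.
rewrite [leRHS]sqr_sqrtr ?mulr_ge0//.
by apply: (le_trans (phi1_dist x0 y0)); rewrite ler_pM2l.
Qed.

Lemma phi1_mesh_cvg : (fun k => phi1 (mesh k)) @ \oo --> (0 : R).
Proof.
have h : phi1 x @[x --> (0 : R)] --> phi1 0 := @phi1_continuous R 0.
by rewrite phi1_0 in h; exact: (cvg_comp mesh phi1 mesh_cvg h).
Qed.

Lemma admissible_ge0 f t : admissible f -> 0 <= f t. Proof. by case. Qed.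

Lemma admissible_limit (y : nat -> R -> R) (x : R -> R) : (forall k, admissible (y k)) ->
  (forall k t, `|y k t - x t| <= mesh k) -> admissible x.
Proof.
move=> ay yx; have cy t : (fun k => y k t) @ \oo --> x t by exact: cvg_mesh_close.
split.
- apply/esym/(@cvg_unique _ (@Rhausdorff R) ((fun k => y k 0) @ \oo)); last exact: cy.
  rewrite (_ : (fun k => y k 0) = cst 0); first exact: cvg_cst.
  by apply/funext => k; have [] := ay k.
- move=> t; apply: (ler_cvg_to (cvg_cst 0) (cy t)).
  by apply: nearW => k; have [] := ay k.
- move=> t; apply: (@cvg_unique _ (@Rhausdorff R) ((fun k => y k t) @ \oo)); first exact: cy.
  rewrite (_ : (fun k => y k t) = (fun k => y k (clamp T t))); first exact: cy.
  by apply/funext => k; have [_ _ + _] := ay k; exact.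
- move=> I u v uv.
  have lim := @kinetic_sum_cvg y x I u v cy.
  apply: (ler_cvg_to lim (cvg_cst (Emax T))).
  by apply: nearW => k; have [_ _ _] := ay k; exact.
Qed.

(** Lower semicontinuity of the cost for uniform convergence. *)
Section lower_semicontinuity.
Variables (a : R -> R) (y : nat -> R -> R) (x : R -> R).
Hypotheses (ca : continuous a) (aB : forall s, 0 <= a s <= phimax T)
  (ay : forall k, admissible (y k)) (yx : forall k t, `|y k t - x t| <= mesh k).

Let ax : admissible x. Proof. exact: admissible_limit ay yx. Qed.

Let cy t : (fun k => y k t) @ \oo --> x t. Proof. exact: cvg_mesh_close. Qed.

Let tint_cvg : (fun k => tint T (fun s => a s * phi1 (y k s))) @ \oo -->
  tint T (fun s => a s * phi1 (x s)).
Proof.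
apply/cvgrPdist_le => e e0.
have hb : (fun k => T * (phimax T * phi1 (mesh k))) @ \oo --> (0 : R).
  rewrite -[X in _ --> X](mulr0 T) -[X in _ * X](mulr0 (phimax T)).
  by apply: cvgM; [exact: cvg_cst|apply: cvgM; [exact: cvg_cst|exact: phi1_mesh_cvg]].
have : \forall k \near \oo, T * (phimax T * phi1 (mesh k)) <= e by exact: (cvgr_le 0 hb).
apply: filterS => k; apply: le_trans; rewrite distrC.
have c1 := mulr_continuous ca (admissible_phi1_continuous T0 (ay k)).
have c2 := mulr_continuous ca (admissible_phi1_continuous T0 ax).
rewrite /= in c1 c2.
have cB : continuous (fun s => a s * phi1 (y k s) + (-1) * (a s * phi1 (x s))).
  move=> s; apply: (@continuousD _ _ _ (fun s => a s * phi1 (y k s)) (fun s => (-1) * (a s * phi1 (x s))) s).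
    exact: c1.
  by apply: (mulr_continuous (g := fun=> -1)); [exact: cst_continuous|exact: c2].
rewrite -[X in _ - X]mul1r -mulNr -(tintZ T (-1) c2) -(tintD T c1); last first.
  by apply: (mulr_continuous (g := fun=> -1)); [exact: cst_continuous|exact: c2].
apply: norm_tint_le => // s _; rewrite mulN1r -mulrBr normrM.
have /andP[a0 aM] := aB s; rewrite (ger0_norm a0) ler_pM//.
apply: phi1_close; [|exact: admissible_ge0 ax|exact: yx].
exact: admissible_ge0 (ay k).
Qed.

Lemma cost1_limit (V : R) : (forall k, cost1 T a (y k) <= V + mesh k) -> cost1 T a x <= V.
Proof.
move=> yV; suff : energy T x <= V + (T * x T - tint T (fun s => a s * phi1 (x s))).
  by rewrite /cost1 /penergy; lra.
have [_ _ _ eX] := ax; apply: ge_energy T0 _ => I u v uv.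
have lim2 : (fun k => V + mesh k + (T * y k T - tint T (fun s => a s * phi1 (y k s)))) @ \oo
    --> V + 0 + (T * x T - tint T (fun s => a s * phi1 (x s))).
  apply: cvgD; first by apply: cvgD; [exact: cvg_cst|exact: mesh_cvg].
  apply: cvgB; last exact: tint_cvg.
  by apply: cvgM; [exact: cvg_cst|exact: cy].
rewrite addr0 in lim2; apply: (ler_cvg_to (@kinetic_sum_cvg y x I u v cy) lim2); apply: nearW => k.
have [_ _ _ eS] := ay k.
apply: (le_trans (energy_le_energy T0 eS uv)).
by have := yV k; rewrite /cost1 /penergy; lra.
Qed.

End lower_semicontinuity.

Section limit.
Variables (U : set_system nat) (L : nat -> ((R -> R) -> R) -> R) (a : R -> R) (V : R).
Hypotheses (UU : UltraFilter U) (mL : forall n, mean T (L n)) (ca : continuous a)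
  (aB : forall s, 0 <= a s <= phimax T)
  (aP : forall s, (fun n => profile (L n) s) @ U --> a s)
  (VP : forall f, admissible f -> V <= cost1 T a f)
  (LV : (fun n => L n (cost1 T a)) @ U --> V).

Let PU : ProperFilter U := @ultra_proper _ U UU.

Let below k j f : R := (code k f < j)%N%:R.

Lemma cdf_ex k j : exists l : R, (fun n => L n (below k j)) @ U --> l.
Proof.
apply: (@ultra_cvg R U _ 1) => // n; apply: (norm_mean_le (mL n)) => f _.
by rewrite /below; case: (_ < _)%N; rewrite ?normr1 ?normr0.
Qed.

(** The limit distribution function of the code at level k. *)
Definition cdf k j : R := projT1 (cid (cdf_ex k j)).

Lemma cdfP k j : (fun n => L n (below k j)) @ U --> cdf k j.
Proof. exact: projT2 (cid (cdf_ex k j)). Qed.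

Lemma cdf_unique k j (l : R) : (fun n => L n (below k j)) @ U --> l -> cdf k j = l.
Proof. by move=> h; apply: (@cvg_unique _ (@Rhausdorff R) ((fun n => L n (below k j)) @ U)) => //; exact: cdfP. Qed.

Lemma cdf0 k : cdf k 0 = 0.
Proof.
apply: cdf_unique; rewrite (_ : (fun n => _) = cst 0); first exact: cvg_cst.
by apply/funext => n; rewrite -[RHS](mean_cst (mL n)).
Qed.

Lemma cdf1 k : cdf k (codes k) = 1.
Proof.
apply: cdf_unique; rewrite (_ : (fun n => _) = cst 1); first exact: cvg_cst.
apply/funext => n; rewrite -[RHS](mean_cst (mL n)); congr (L n _).
by apply/funext => f; rewrite /below ltn_code.
Qed.

Lemma cdf_homo k : {homo cdf k : i j / (i <= j)%N >-> i <= j}.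
Proof.
move=> i j ij; apply: (ler_cvg_to (@cdfP k i) (@cdfP k j)); apply: nearW => n.
apply: (le_mean (mL n)) => f _; rewrite /below ler_nat.
by case: ltnP => // fi; rewrite (leq_trans fi ij).
Qed.

Lemma cdfS k j : cdf k.+1 (j * digits k) = cdf k j.
Proof.
apply: cdf_unique; rewrite (_ : (fun n => _) = (fun n => L n (below k j))); first exact: cdfP.
apply/funext => n; congr (L n _); apply/funext => f.
by rewrite /below -ltn_divLR ?digits_gt0// code_div.
Qed.

(** The quantile function of that distribution. *)
Definition cell k (w : R) : nat :=
  xget 0%N [set j | (j < codes k)%N /\ cdf k j <= w < cdf k j.+1].

Lemma cell_unique k w i j : cdf k i <= w < cdf k i.+1 -> cdf k j <= w < cdf k j.+1 -> i = j.
Proof.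
move=> /andP[i1 i2] /andP[j1 j2]; apply/eqP; rewrite eqn_leq; apply/andP; split; rewrite leqNgt; apply/negP => ij.
  by have := lt_le_trans j2 (le_trans (cdf_homo k ij) i1); rewrite ltxx.
by have := lt_le_trans i2 (le_trans (cdf_homo k ij) j1); rewrite ltxx.
Qed.

Lemma cellP k w : 0 <= w < 1 -> (cell k w < codes k)%N /\ cdf k (cell k w) <= w < cdf k (cell k w).+1.
Proof.
move=> /andP[w0 w1]; have ex : exists j, w < cdf k j by exists (codes k); rewrite cdf1.
have := ex_minnP ex => -[[|m] wm mmin]; first by move: wm; rewrite cdf0 ltNge w0.
suff : [set j | (j < codes k)%N /\ cdf k j <= w < cdf k j.+1] m.
  by move=> Pm; exact: (xgetPex 0%N (ex_intro _ m Pm)).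
split=> /=; last first.
  rewrite wm andbT leNgt; apply/negP => /mmin; by rewrite ltnn.
by apply: mmin; rewrite cdf1.
Qed.

(** The cells selected by a point are nested. *)
Lemma cell_div k w : 0 <= w < 1 -> (cell k.+1 w %/ digits k)%N = cell k w.
Proof.
move=> w01; have [_ /andP[h1 h2]] := cellP k.+1 w01; have [_ h] := cellP k w01.
apply: (@cell_unique k w) => //; apply/andP; split.
  by rewrite -cdfS; apply: le_trans h1; apply: cdf_homo; exact: leq_divM.
rewrite -cdfS; apply: (lt_le_trans h2); apply: cdf_homo.
by rewrite -ltn_divLR ?digits_gt0.
Qed.

Let charged k j f : R := (code k f == j)%:R.

Lemma below_charged k j f : below k j.+1 f - below k j f = charged k j f.
Proof.
rewrite /below /charged ltnS; case: (ltngtP (code k f) j) => //= _;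
  by rewrite ?subrr ?subr0.
Qed.

Lemma charged_cvg k j : (fun n => L n (charged k j)) @ U --> cdf k j.+1 - cdf k j.
Proof.
rewrite (_ : (fun n => _) = (fun n => L n (below k j.+1) - L n (below k j))).
  by apply: cvgB; exact: cdfP.
apply/funext => n; rewrite -(meanB (mL n)); congr (L n _).
by apply/funext => f; rewrite below_charged.
Qed.

(** By Markov's inequality: the mean of the nonnegative excess cost1 a - V tends to 0,
    so the curves whose excess is at least e have limit mass 0. *)
Lemma charged_cell k j (e : R) : cdf k j < cdf k j.+1 -> 0 < e ->
  exists f, [/\ admissible f, code k f = j & cost1 T a f <= V + e].
Proof.
move=> jj e0; apply: contrapT => no.
suff : cdf k j.+1 - cdf k j <= 0 by rewrite subr_le0 leNgt jj.
have lcvg : (fun n => e^-1 * (L n (cost1 T a) - V)) @ U --> (0 : R).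
  rewrite -[X in _ --> X](mulr0 e^-1) -[X in _ * X](subrr V).
  apply: cvgM; first exact: cvg_cst.
  by apply: cvgB => //; exact: cvg_cst.
apply: (ler_cvg_to (@charged_cvg k j) lcvg); apply: nearW => n.
rewrite -[X in _ - X](mean_cst (mL n)) -(meanB (mL n)) -(meanZ (mL n)).
apply: (le_mean (mL n)) => f af; have Vf := VP af.
rewrite /charged; case: eqP => [fj|_]; last first.
  by rewrite mulr_ge0 ?invr_ge0 ?subr_ge0// ltW.
rewrite -(ler_pM2l e0) mulrA mulfV ?gt_eqF// mul1r mulr1 lerBrDl.
by rewrite leNgt; apply/negP => /ltW fV; apply: no; exists f.
Qed.

(** For the averages the representative must lie in its own cell as soon as this cell
    is not empty, even if it has mass 0. *)
Lemma representative_ex k j : exists r, [/\ admissible r,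
  (forall f, admissible f -> code k f = j -> code k r = j) &
  (cdf k j < cdf k j.+1 -> code k r = j /\ cost1 T a r <= V + mesh k)].
Proof.
have [jj|] := boolP (cdf k j < cdf k j.+1).
  have [f [af fj fV]] := charged_cell jj (mesh_gt0 k).
  by exists f; split.
have [[f [af fj]]|no _] := pselect (exists f, admissible f /\ code k f = j).
  by exists f; split => //; rewrite (negbTE _).
exists (fun=> 0); split => //; first exact: admissible0.
by move=> f af fj; case: no; exists f.
Qed.

Definition representative k j : R -> R := projT1 (cid (representative_ex k j)).

Lemma representative_admissible k j : admissible (representative k j).
Proof. by have [] := projT2 (cid (representative_ex k j)). Qed.

Lemma code_representative k f : admissible f -> code k (representative k (code k f)) = code k f.
Proof. by move=> af; have [_ h _] := projT2 (cid (representative_ex k (code k f))); exact: (h f). Qed.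

Lemma charged_representative k j : cdf k j < cdf k j.+1 ->
  code k (representative k j) = j /\ cost1 T a (representative k j) <= V + mesh k.
Proof. by have [_ _ h] := projT2 (cid (representative_ex k j)); exact: h. Qed.

(** Points outside [0,1[ are sent to 0, so that every real w selects a cell of
    positive mass. *)
Definition wrap (w : R) : R := if 0 <= w < 1 then w else 0.

Lemma wrap_itv w : 0 <= wrap w < 1.
Proof. by rewrite /wrap; case: ifP => // _; rewrite lexx ltr01. Qed.

Definition step k (w : R) : R -> R := representative k (cell k (wrap w)).

Lemma step_admissible k w : admissible (step k w).
Proof. exact: representative_admissible. Qed.

Lemma code_step k w : code k (step k w) = cell k (wrap w).
Proof.
have [_ /andP[h1 h2]] := cellP k (wrap_itv w).
by have [] := charged_representative (le_lt_trans h1 h2).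
Qed.

Lemma step_cost k w : cost1 T a (step k w) <= V + mesh k.
Proof.
have [_ /andP[h1 h2]] := cellP k (wrap_itv w).
by have [] := charged_representative (le_lt_trans h1 h2).
Qed.

Lemma code_step_le k l w : (k <= l)%N -> code k (step l w) = cell k (wrap w).
Proof.
move=> kl; have : code l (step l w) = cell l (wrap w) by exact: code_step.
set f := step l w; move: kl; elim: l {f}(f) => [|l IH] f.
  by rewrite leqn0 => /eqP ->.
rewrite leq_eqVlt => /predU1P[-> //|]; rewrite ltnS => kl fl.
by apply: IH => //; rewrite -code_div fl cell_div// wrap_itv.
Qed.

Lemma step_close k l m w t : (k < l)%N -> (k < m)%N -> `|step l w t - step m w t| <= mesh k.
Proof.
move=> kl km; apply: code_close; [exact: step_admissible|exact: step_admissible|].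
by rewrite !code_step_le.
Qed.

Lemma step_cvg w t : exists l : R, (fun k => step k w t) @ \oo --> l.
Proof.
apply/cvg_ex; apply/cauchy_cvgP/cauchy_exP => e e0.
have : \forall k \near \oo, mesh k < e by exact: (cvgr_lt 0 mesh_cvg).
move=> [k _ /(_ k (leqnn k)) /= ke]; exists (step k.+1 w t).
exists k.+1 => // l /= kl; rewrite /ball/=.
by apply: le_lt_trans ke; exact: step_close.
Qed.

(** The steps at w are eventually in the same small cells, hence converge. *)
Definition curve_of (w t : R) : R := projT1 (cid (step_cvg w t)).

Lemma curve_of_cvg w t : (fun k => step k w t) @ \oo --> curve_of w t.
Proof. exact: projT2 (cid (step_cvg w t)). Qed.

Lemma curve_of_close k l w t : (k < l)%N -> `|step l w t - curve_of w t| <= mesh k.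
Proof.
move=> kl; have h : (fun m => `|step l w t - step m w t|) @ \oo --> `|step l w t - curve_of w t|.
  by apply: cvg_norm; apply: cvgB; [exact: cvg_cst|exact: curve_of_cvg].
apply: (ler_cvg_to h (cvg_cst (mesh k))); exists k.+1 => // m /= km.
exact: step_close.
Qed.

Lemma stepS_cvg w t : (fun k => step k.+1 w t) @ \oo --> curve_of w t.
Proof. by apply: cvg_mesh_close => k; exact: curve_of_close. Qed.

Lemma curve_of_admissible w : admissible (curve_of w).
Proof.
by apply: (@admissible_limit (fun k => step k.+1 w)) => k; [exact: step_admissible|move=> t; exact: curve_of_close].
Qed.

Lemma curve_of_cost w : cost1 T a (curve_of w) <= V.
Proof.
apply: (@cost1_limit a (fun k => step k.+1 w)) => // k.
- exact: step_admissible.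
- by move=> t; exact: curve_of_close.
- apply: (le_trans (step_cost _ _)); rewrite lerD2l /mesh lef_pV2 ?posrE// ler_nat.
  exact: leqnSn.
Qed.

Lemma phi1_step_cvg w s : (fun k => phi1 (step k.+1 w s)) @ \oo --> phi1 (curve_of w s).
Proof.
have h : phi1 x @[x --> curve_of w s] --> phi1 (curve_of w s) := @phi1_continuous R (curve_of w s).
apply: (cvg_comp (fun k => step k.+1 w s) phi1 _ h); exact: stepS_cvg.
Qed.

Let cells k j : set (measurableTypeR R) := `[cdf k j, cdf k j.+1[%classic.

Let mcells k j : measurable (cells k j).
Proof. exact: measurable_itv. Qed.

Lemma cells_itv01 k j : (j < codes k)%N -> cells k j `<=` `[0, 1[%classic.
Proof.
move=> jk w; rewrite /cells/= !in_itv/= => /andP[h1 h2].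
rewrite (le_trans _ h1) ?(lt_le_trans h2)//.
  by rewrite -(cdf1 k); exact: cdf_homo.
by rewrite -(cdf0 k); exact: cdf_homo.
Qed.

Lemma cell_cells k j w : 0 <= w < 1 -> cells k j w -> cell k w = j.
Proof.
move=> w01; have [_ h] := cellP k w01; rewrite /cells/= in_itv/= => h'.
exact: cell_unique h h'.
Qed.

Lemma cells_cell k w : 0 <= w < 1 -> cells k (cell k w) w.
Proof. by move=> w01; have [_ h] := cellP k w01; rewrite /cells/= in_itv. Qed.

Lemma measurable_step k (P : (R -> R) -> Prop) :
  measurable ([set w | P (step k w)] : set (measurableTypeR R)).
Proof.
have m01 : measurable (`[0, 1[%classic : set (measurableTypeR R)) by exact: measurable_itv.
rewrite (_ : [set w | _] = (~` `[0, 1[%classic `&` [set w | P (step k 0)]) `|`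
  \bigcup_(j in [set j | (j < codes k)%N /\ P (representative k j)]) cells k j).
  apply: measurableU; last by apply: bigcup_measurable => j _.
  apply: measurableI; first exact: measurableC.
  have [P0|nP0] := pselect (P (step k 0)).
    by rewrite (_ : [set w | _] = setT)//; apply/seteqP; split.
  by rewrite (_ : [set w | _] = set0)//; apply/seteqP; split.
have step0 w : ~~ (0 <= w < 1) -> step k w = step k 0.
  by move=> w01; rewrite /step /wrap (negbTE w01) lexx ltr01.
apply/seteqP; split=> [w /= Pw|w /= [[nw P0]|[j [jk Pj] wj]]].
- have [w01|w01] := boolP (0 <= w < 1); last first.
    left; split; first by move=> h; move: w01; move: h; rewrite /= in_itv/= => ->.
    by rewrite -(step0 w).
  right; exists (cell k w); last exact: cells_cell.
  have [h _] := cellP k w01; split => //.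
  by move: Pw; rewrite /step /wrap w01.
- by rewrite step0//; apply/negP => h; apply: nw; rewrite /= in_itv.
- have := cells_itv01 jk wj; rewrite /= in_itv/= => w01.
  by rewrite /step /wrap w01 (cell_cells w01 wj).
Qed.

Lemma mean_sum n (I : finType) (F : I -> (R -> R) -> R) :
  L n (fun f => \sum_i F i f) = \sum_i L n (F i).
Proof.
elim: (index_enum I) => [|i r IH].
  rewrite big_nil -[RHS](mean_cst (mL n)); congr (L n _).
  by apply/funext => f; rewrite big_nil.
rewrite big_cons -IH -(meanD (mL n)); congr (L n _).
by apply/funext => f; rewrite big_cons.
Qed.

(** Replacing each curve by the representative of its cell moves phi1 by at most
    phi1 (mesh k), uniformly. *)
Lemma average_representative k s :
  `|a s - \sum_(j < codes k.+1) (cdf k.+1 j.+1 - cdf k.+1 j) * phi1 (representative k.+1 j s)|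
  <= phi1 (mesh k).
Proof.
pose S n := \sum_(j < codes k.+1) L n (charged k.+1 j) * phi1 (representative k.+1 j s).
have ScvgE : S @ U --> \sum_(j < codes k.+1) (cdf k.+1 j.+1 - cdf k.+1 j) * phi1 (representative k.+1 j s).
  rewrite /S; elim: (index_enum _) => [|j r IH].
    rewrite big_nil (_ : (fun n => _) = cst 0); first exact: cvg_cst.
    by apply/funext => n; rewrite big_nil.
  rewrite big_cons (_ : (fun n => _) = (fun n => L n (charged k.+1 j) * phi1 (representative k.+1 j s) +
    \sum_(i <- r) L n (charged k.+1 i) * phi1 (representative k.+1 i s))); last first.
    by apply/funext => n; rewrite big_cons.
  apply: cvgD => //; apply: cvgM; last exact: cvg_cst.
  exact: charged_cvg.
have h : (fun n => profile (L n) s - S n) @ U --> a s -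
    \sum_(j < codes k.+1) (cdf k.+1 j.+1 - cdf k.+1 j) * phi1 (representative k.+1 j s).
  by apply: cvgB.
apply: (ler_cvg_to (cvg_norm h) (cvg_cst (phi1 (mesh k)))); apply: nearW => n.
have -> : S n = L n (fun f => \sum_(j < codes k.+1) phi1 (representative k.+1 j s) * charged k.+1 j f).
  by rewrite mean_sum; apply: eq_bigr => j _; rewrite (meanZ (mL n)) mulrC.
rewrite /profile -(meanB (mL n)); apply: (norm_mean_le (mL n)) => f af.
rewrite (bigD1 (Ordinal (ltn_code k.+1 f))) // [X in _ - (_ + X)]big1 ?addr0; last first.
  move=> j jf; rewrite /charged; case: eqP => [fj|_]; last by rewrite mulr0.
  by move/andP: jf => [_ /eqP[]]; apply/val_inj; exact: esym fj.
rewrite /charged eqxx mulr1.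
have ar := representative_admissible k.+1 (code k.+1 f).
apply: phi1_close; [exact: admissible_ge0 af|exact: admissible_ge0 ar|].
by apply: code_close => //; rewrite code_representative.
Qed.

Let step_value k s w : R := \sum_(j < codes k) phi1 (representative k j s) * \1_(cells k j) w.

Lemma step_valueE k s w : 0 <= w < 1 -> phi1 (step k w s) = step_value k s w.
Proof.
move=> w01; have [ck _] := cellP k w01.
rewrite /step_value (bigD1 (Ordinal ck))//= [X in _ + X]big1 ?addr0; last first.
  move=> j jc; rewrite indicE; case: (boolP (w \in cells k j)); rewrite ?mulr0//.
  rewrite inE => /(cell_cells w01) cj; case/eqP: jc.
  by apply/val_inj; rewrite /= cj.
by rewrite indicE mem_set ?mulr1 /step /wrap ?w01//; exact: cells_cell.
Qed.

Lemma measurable_step_value k s (D : set (measurableTypeR R)) : measurable_fun D (step_value k s).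
Proof.
apply: measurable_sum => j; apply: measurable_funM => //.
Qed.

Let D01 : set (measurableTypeR R) := `[0, 1[%classic.

Let mD01 : measurable D01. Proof. exact: measurable_itv. Qed.

Let muD01 : mu D01 = 1%E.
Proof. by rewrite lebesgue_measure_itv/= lte_fin ltr01 oppr0 adde0. Qed.

Lemma integral_step k s : (\int[mu]_(w in D01) (phi1 (step k w s))%:E =
  (\sum_(j < codes k) (cdf k j.+1 - cdf k j) * phi1 (representative k j s))%:E)%E.
Proof.
have -> : (\int[mu]_(w in D01) (phi1 (step k w s))%:E = \int[mu]_(w in D01) (step_value k s w)%:E)%E.
  by apply: eq_integral => w; rewrite inE /D01/= in_itv/= => w01; rewrite step_valueE.
rewrite /step_value; under eq_integral do rewrite -sumEFin.
rewrite ge0_integral_sum//; last 2 first.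
- by move=> j; apply/measurable_EFinP/measurable_funM => //; apply: measurable_indic; exact: mcells.
- by move=> j w _; rewrite lee_fin mulr_ge0// phi1_ge0.
rewrite -sumEFin; apply: eq_bigr => j _.
rewrite (_ : (fun w => _) = (fun w => (phi1 (representative k j s))%:E * (\1_(cells k j) w)%:E)%E) //.
rewrite ge0_integralZl//; last 2 first.
- by apply/measurable_EFinP; apply: measurable_indic; exact: mcells.
- by rewrite lee_fin phi1_ge0.
rewrite integral_indic//= setIidl; last exact: cells_itv01.
rewrite lebesgue_measure_itv/= lte_fin mulrC EFinM.
have := cdf_homo k (leqnSn j); rewrite le_eqVlt => /predU1P[->|h].
  by rewrite ltxx subrr.
by rewrite h.
Qed.

Lemma measurable_curve_of s : measurable_fun D01 (fun w => phi1 (curve_of w s)).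
Proof.
apply: (@measurable_fun_cvg _ _ _ _ (fun k => step_value k.+1 s)).
- by move=> k; exact: measurable_step_value.
- move=> w; rewrite /D01/= in_itv/= => w01.
  have hc := @phi1_step_cvg w s.
  by under eq_fun do rewrite -step_valueE//.
Qed.

Lemma curve_average s : (\int[mu]_(w in D01) (phi1 (curve_of w s))%:E = (a s)%:E)%E.
Proof.
have msv k : measurable_fun D01 (fun w => (phi1 (step k w s))%:E).
  apply/measurable_EFinP; apply: (eq_measurable_fun (step_value k s)); last exact: measurable_step_value.
  by move=> w; rewrite inE /D01/= in_itv/= => w01; rewrite step_valueE.
have mc : measurable_fun D01 (fun w => (phi1 (curve_of w s))%:E).
  by apply/measurable_EFinP; exact: measurable_curve_of.
have close k w : `|phi1 (step k.+1 w s) - phi1 (curve_of w s)| <= phi1 (mesh k).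
  apply: phi1_close; [exact: admissible_ge0 (step_admissible _ _)| |exact: curve_of_close].
  exact: admissible_ge0 (curve_of_admissible w).
have cst_int (c : R) : (\int[mu]_(w in D01) c%:E = c%:E)%E.
  by rewrite integral_cst//= [X in (_ * X)%E]muD01 mule1.
have add_cst (f : R -> R) (c : R) : (forall w, 0 <= f w) -> 0 <= c -> measurable_fun D01 (EFin \o f) ->
    (\int[mu]_(w in D01) (f w + c)%:E = \int[mu]_(w in D01) (f w)%:E + c%:E)%E.
  move=> f0 c0 mf; under eq_integral do rewrite EFinD.
  rewrite ge0_integralD ?cst_int//.
  by move=> w _; rewrite lee_fin.
have p0 := @phi1_ge0 R.
pose A k := \sum_(j < codes k.+1) (cdf k.+1 j.+1 - cdf k.+1 j) * phi1 (representative k.+1 j s).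
have AE k : (\int[mu]_(w in D01) (phi1 (step k.+1 w s))%:E = (A k)%:E)%E by exact: integral_step.
have up k : (\int[mu]_(w in D01) (phi1 (curve_of w s))%:E <= (A k + phi1 (mesh k))%:E)%E.
  rewrite EFinD -AE -add_cst//; last exact: msv.
  apply: ge0_le_integral => //.
  - by move=> w _; rewrite lee_fin.
  - by under eq_fun do rewrite EFinD; apply: emeasurable_funD.
  - by move=> w _; rewrite lee_fin; have := close k w; rewrite ler_norml => /andP[]; lra.
have lo k : ((A k)%:E <= \int[mu]_(w in D01) (phi1 (curve_of w s))%:E + (phi1 (mesh k))%:E)%E.
  rewrite -AE -add_cst//.
  apply: ge0_le_integral => //.
  - by move=> w _; rewrite lee_fin.
  - by under eq_fun do rewrite EFinD; apply: emeasurable_funD.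
  - by move=> w _; rewrite lee_fin; have := close k w; rewrite ler_norml => /andP[]; lra.
have fin : (\int[mu]_(w in D01) (phi1 (curve_of w s))%:E \is a fin_num)%E.
  rewrite ge0_fin_numE; first exact: le_lt_trans (up 0%N) (ltry _).
  by apply: integral_ge0 => w _; rewrite lee_fin.
rewrite -(fineK fin); congr EFin; set x := fine _.
have xA k : `|x - A k| <= phi1 (mesh k).
  have := up k; have := lo k; rewrite -(fineK fin) -/x -EFinD !lee_fin ler_norml => h1 h2.
  by apply/andP; split; lra.
apply/eqP; rewrite -subr_eq0 -normr_le0.
have hb : (fun k => phi1 (mesh k) + phi1 (mesh k)) @ \oo --> (0 + 0 : R).
  by apply: cvgD; exact: phi1_mesh_cvg.
rewrite addr0 in hb; apply: (ler_cvg_to (cvg_cst `|x - a s|) hb); apply: nearW => k.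
rewrite (_ : x - a s = (x - A k) - (a s - A k)); last by ring.
apply: (le_trans (ler_normB _ _)); apply: lerD; first exact: xA.
exact: average_representative.
Qed.

End limit.

(** X is the random curve and Y k its approximation by finitely many curves; the last
    clause, which holds for all predicates P, is where the measurability of X comes
    from. *)
Lemma random_equilibrium : exists (a : R -> R) (V : R) (X : R -> R -> R) (Y : nat -> R -> R -> R),
  [/\ continuous a, forall s, 0 <= a s <= phimax T, forall f, admissible f -> V <= cost1 T a f &
      forall w, admissible (X w)] /\
  [/\ forall w, cost1 T a (X w) <= V,
      forall s, (\int[mu]_(w in `[0%R, 1%R[) (phi1 (X w s))%:E = (a s)%:E)%E,
      forall k w t, `|Y k w t - X w t| <= mesh k,
      forall k w, admissible (Y k w) &
      forall k (P : (R -> R) -> Prop),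
        measurable ([set w | P (Y k w)] : set (measurableTypeR R))].
Proof.
have [U [L [a [V [[UU mL ca aB] [aP VP LV]]]]]] := cost_equilibrium T0.
exists a, V, (curve_of UU mL VP LV), (fun k => step UU mL VP LV k.+1).
split; split => //.
- by move=> w; exact: curve_of_admissible.
- by move=> w; exact: curve_of_cost.
- by move=> s; exact: curve_average.
- by move=> k w t; exact: curve_of_close.
- by move=> k w; exact: step_admissible.
- by move=> k P; exact: measurable_step.
Qed.

End random_curve.

(** * Non-measurable integrands *)
Section nonmeasurable_integrand.
Context d (X : measurableType d) (R : realType) (nu : {measure set X -> \bar R}).
Import HBNNSimple.

(** The integral of a nonnegative function is the supremum of the integrals of the
    simple functions below it, and these can be set to 0 on a measurable null set;
    the functions themselves are arbitrary. *)
Lemma ge0_ae_le_integral (D : set X) (f g : X -> \bar R) :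
  (forall x, (0 <= f x)%E) -> (forall x, (0 <= g x)%E) ->
  {ae nu, forall x, D x -> (f x <= g x)%E} ->
  (\int[nu]_(x in D) f x <= \int[nu]_(x in D) g x)%E.
Proof.
move=> f0 g0 [N [mN N0 fgN]]; rewrite !ge0_integralE//.
apply: ge_ereal_sup => _ [h hf <-].
pose h' := proj_nnsfun h (measurableC mN).
have -> : sintegral nu h = sintegral nu h'.
  rewrite -!integralT_nnsfun; apply: ae_eq_integral => //.
  - by apply/measurable_EFinP.
  - by apply/measurable_EFinP.
  exists N; split => // x /= hh; apply: contrapT => Nx; apply: hh => _.
  by rewrite /h' /proj_nnsfun /= mindicE mem_set ?mulr1.
apply: ereal_sup_ubound; exists h' => // x /=.
rewrite /h' /proj_nnsfun /= mindicE; case: (boolP (x \in ~` N)) => [|_].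
  rewrite inE => Nx; rewrite mulr1; apply: (le_trans (hf x)).
  rewrite /patch; case: ifPn => // /set_mem Dx; apply: contrapT => fg.
  by apply: Nx; apply: fgN => /=; apply: contra_not fg; exact.
by rewrite mulr0 /patch; case: ifP.
Qed.

End nonmeasurable_integrand.

(** * The cost of curves in space *)
Section curves_in_space.
Context {R : realType} {d : nat}.
Variables (i0 : 'I_d) (T : R).
Hypothesis T0 : 0 < T.
Notation mu := (@lebesgue_measure R).

Definition axis (x : R) : 'rV[R]_d := \row_i (if i == i0 then x else 0).

Lemma axisB x y : axis x - axis y = axis (x - y).
Proof. by apply/rowP => i; rewrite !mxE; case: eqP; rewrite ?subrr. Qed.

Lemma enorm_axis x : enorm (axis x) = `|x|.
Proof.
rewrite /enorm (bigD1 i0)//= mxE eqxx big1 ?addr0 ?sqrtr_sqr// => i /negbTE ii.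
by rewrite mxE ii expr0n.
Qed.

Lemma axis_sign (b : bool) (x : R) : enorm (axis ((-1) ^+ b * x)) = `|x|.
Proof. by rewrite enorm_axis normrM normr_sign mul1r. Qed.

Lemma le_enorm (x : 'rV[R]_d) i : `|x ord0 i| <= enorm x.
Proof.
rewrite -sqrtr_sqr; apply: ler_wsqrtr; rewrite (bigD1 i)//= lerDl.
by apply: sumr_ge0 => j _; exact: sqr_ge0.
Qed.

Lemma curve_clamp (g : curve d T) t : g t = g (clamp T t).
Proof. by have [_] := set_mem (valP g); exact. Qed.

Lemma curve_row_ac (g : curve d T) : row_ac g.
Proof.
move=> i e e0; have [acg _] := set_mem (valP g).
have [delta delta0 H] := acg e e0; exists delta => // I u v uv tuv suv.
pose u' (k : 'I_#|I|) := clamp T (u (enum_val k)).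
pose v' (k : 'I_#|I|) := clamp T (v (enum_val k)).
have sumE (F : I -> R) : \sum_(k < #|I|) F (enum_val k) = \sum_j F j.
  by rewrite -(big_enum_val F); exact: eq_bigl.
have := H #|I| u' v'.
rewrite (sumE (fun j => clamp T (v j) - clamp T (u j))).
rewrite (sumE (fun j => enorm (g (clamp T (v j)) - g (clamp T (u j))))) => h.
apply: le_lt_trans (h _ _ _).
- apply: ler_sum => j _; rewrite -!curve_clamp; apply: le_trans (le_enorm _ i).
  by rewrite !mxE.
- move=> k; split; [by case/andP: (clamp_itv T0 (u (enum_val k)))| |by case/andP: (clamp_itv T0 (v (enum_val k)))].
  by apply: le_clamp => //; exact: uv.
- move=> j k _ _ jk; apply: enum_val_inj; apply: (tuv _ _ Logic.I Logic.I).
  by case: jk => x [/clamp_oo hj /clamp_oo hk]; exists x; split; [exact: hj|exact: hk].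
- by apply: le_lt_trans suv; apply: ler_sum => j _; exact: clampB.
Qed.

Lemma enorm_continuous (Y : topologicalType) (h : Y -> 'rV[R]_d) :
  (forall i, continuous (fun y => h y ord0 i)) -> continuous (fun y => enorm (h y)).
Proof.
move=> ch y.
have cs r : continuous (fun y => \sum_(i <- r) h y ord0 i ^+ 2).
  elim: r => [|i r IH] z.
    rewrite (_ : (fun _ => _) = cst 0); first exact: cvg_cst.
    by apply/funext => x; rewrite big_nil.
  rewrite (_ : (fun _ => _) = (fun x => h x ord0 i * h x ord0 i + \sum_(j <- r) h x ord0 j ^+ 2)).
    by apply: cvgD; [apply: cvgM; exact: ch|exact: IH].
  by apply/funext => x; rewrite big_cons expr2.
by apply: (@continuous_comp Y R R _ Num.sqrt); [exact: cs|exact: sqrt_continuous].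
Qed.

Lemma curve_enorm_continuous (g : curve d T) : continuous (fun s => enorm (g s)).
Proof. by apply: enorm_continuous => i; exact: ac_continuous (curve_row_ac g i). Qed.

Lemma ray_ac (b : bool) f : admissible T f ->
  ((fun t => axis ((-1) ^+ b * f t)) : {uniform R -> 'rV[R]_d}) \in ac_curves d T.
Proof.
move=> [f0 fge fT fE]; rewrite inE; split; last by move=> t; rewrite fT.
move=> e e0; have [delta delta0 H] := energy_le_ac T0 fE fT e0.
exists delta => // n u v uv tuv suv.
rewrite (eq_bigr (fun i => `|f (v i) - f (u i)|)); last first.
  by move=> i _; rewrite axisB -mulrBr axis_sign.
by apply: H => // i; have [] := uv i.
Qed.

Definition ray b f (af : admissible T f) : curve d T := SigSub (ray_ac b af).

Variables (a : R -> R) (V : R).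
Hypotheses (ca : continuous a) (aB : forall s, 0 <= a s <= phimax T)
  (VP : forall f, admissible T f -> V <= cost1 T a f).

Definition action (g : R -> 'rV[R]_d) : \bar R :=
  (\int[mu]_(s in `[0%R, T]) (2^-1 * enorm (derive1 g s) ^+ 2 + phi (g s) * a s)%:E +
   (- T * enorm (g T))%:E)%E.

Let mT : measurable (`[0, T]%classic : set (measurableTypeR R)).
Proof. exact: measurable_itv. Qed.

(** Where g is not differentiable its derivative is unspecified, so the integrand of
    the action need not be measurable. *)
Lemma action_density (g : curve d T) (q : 'I_d -> R -> R) :
  (forall i, measurable_fun setT (q i)) ->
  {ae mu, forall s, 0 < s < T -> derive1 g s = \row_i q i s} ->
  action g = (\int[mu]_(s in `[0%R, T]) (2^-1 * \sum_i q i s ^+ 2)%:E +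
    (tint T (fun s => a s * phi1 (enorm (g s))) - T * enorm (g T))%:E)%E.
Proof.
move=> mq dq.
have cp : continuous (fun s => a s * phi1 (enorm (g s))).
  apply: mulr_continuous => // s.
  by apply: (@continuous_comp _ _ _ (fun s => enorm (g s)) phi1); [exact: curve_enorm_continuous|exact: phi1_continuous].
have a0 s : 0 <= a s by have /andP[] := aB s.
have q0 s : 0 <= 2^-1 * \sum_i q i s ^+ 2.
  by rewrite mulr_ge0// sumr_ge0// => i _; exact: sqr_ge0.
have p0 s : 0 <= a s * phi1 (enorm (g s)) by rewrite mulr_ge0// phi1_ge0.
rewrite EFinB addeA /action mulNr EFinN; congr (_ - _)%E.
have -> : (tint T (fun s => a s * phi1 (enorm (g s))))%:E =
    (\int[mu]_(s in `[0%R, T]) (a s * phi1 (enorm (g s)))%:E)%E.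
  by rewrite /tint /Rintegral fineK//; apply: integrable_fin_num => //; exact: continuous_integrable.
have mqq : measurable_fun `[0%R, T] (fun s => (2^-1 * \sum_i q i s ^+ 2)%:E).
  apply/measurable_EFinP/measurable_funM => //; apply: measurable_sum => i.
  by apply: measurable_funX; exact: measurable_funS (mq i).
have mp : measurable_fun `[0%R, T] (fun s => (a s * phi1 (enorm (g s)))%:E).
  by have /integrableP[] := continuous_integrable T cp.
rewrite -ge0_integralD//; last 2 first.
- by move=> s _; rewrite lee_fin.
- by move=> s _; rewrite lee_fin.
have ends : {ae mu, forall s, s != 0 /\ s != T}.
  exists [set 0; T]; split; first exact: measurableU.
    apply/eqP; rewrite eq_le measure_ge0 andbT; apply: (le_trans (measureU2 _ _ _)) => //.
    by rewrite -[leRHS]adde0; apply: leeD; rewrite le_eqVlt; apply/orP; left; apply/eqP; exact: lebesgue_measure_set1.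
  move=> s /= h; have [->|s0] := eqVneq s 0; first by left.
  by right; apply: contrapT => /eqP sT; apply: h.
have E : {ae mu, forall s, `[0%R, T]%classic s ->
    (2^-1 * enorm (derive1 g s) ^+ 2 + phi (g s) * a s) =
    (2^-1 * \sum_i q i s ^+ 2) + a s * phi1 (enorm (g s))}.
  apply: filterS2 ends dq; first exact: (ae_filter_ringOfSetsType mu).
  move=> s [sn0 snT] dqs; rewrite /= in_itv/= => /andP[s0 sT].
  rewrite dqs; last by rewrite lt_neqAle eq_sym sn0 s0 lt_neqAle snT sT.
  rewrite enorm_sqr mulrC [phi _ * _]mulrC; congr (_ + _); rewrite mulrC; congr (_ * _).
  by apply: eq_bigr => i _; rewrite mxE.
apply/eqP; rewrite eq_le; apply/andP; split; apply: ge0_ae_le_integral.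
- by move=> s; rewrite lee_fin addr_ge0// mulr_ge0// ?sqr_ge0// sqrtr_ge0.
- by move=> s; rewrite -EFinD lee_fin addr_ge0.
- apply: filterS E; first exact: (ae_filter_ringOfSetsType mu).
  by move=> s /= H Ts; rewrite H.
- by move=> s; rewrite -EFinD lee_fin addr_ge0.
- by move=> s; rewrite lee_fin addr_ge0// mulr_ge0// ?sqr_ge0// sqrtr_ge0.
- apply: filterS E; first exact: (ae_filter_ringOfSetsType mu).
  by move=> s /= H Ts; rewrite H.
Qed.

(** Compare with the rest curve. *)
Lemma value_le0 : V <= 0.
Proof.
apply: (le_trans (VP (admissible0 T0))); rewrite /cost1 /penergy mulr0 subr0.
rewrite (_ : (fun s => _) = fun=> 0); last by apply/funext => s; rewrite phi1_0 mulr0.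
rewrite (tint_cst T0) mulr0 addr0; apply: (ge_energy T0) => I u v _.
by rewrite /kinetic_sum big1// => i _; rewrite subrr expr0n mul0r.
Qed.

(** The distance to the origin is an admissible scalar curve when the energy of h is
    at most 2 T^3. *)
Lemma action_ge (h : curve d T) : h 0 = 0 -> (V%:E <= action h)%E.
Proof.
move=> h0; have [q [qi dq qE]] := row_ac_density T0 (curve_row_ac h).
have mq i : measurable_fun setT (q i) by have /integrableP[/measurable_EFinP] := qi i.
rewrite (action_density mq dq).
set W := (\int[mu]_(s in _) _)%E in qE *.
have W0 : (0 <= W)%E.
  by apply: integral_ge0 => s _; rewrite lee_fin mulr_ge0// sumr_ge0// => i _; exact: sqr_ge0.
have [Woo|Wfin] := eqVneq W +oo%E; first by rewrite Woo addye// leey.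
have {}Wfin : (W \is a fin_num)%E by rewrite ge0_fin_numE// ltey.
move: qE W0; rewrite -(fineK Wfin); set w := fine W => qE w0.
have {}w0 : 0 <= w by rewrite -lee_fin.
have nh t : 0 <= enorm (h t) by exact: enorm_ge0.
have eh : energy_le T (fun t => enorm (h t)) w by move=> I u v uv; rewrite -lee_fin; exact: qE.
have enorm0 : enorm (h 0) = 0.
  by rewrite h0 /enorm big1 ?sqrtr0// => i _; rewrite mxE expr0n.
have cp : continuous (fun s => a s * phi1 (enorm (h s))).
  apply: mulr_continuous => // s.
  by apply: (@continuous_comp _ _ _ (fun s => enorm (h s)) phi1); [exact: curve_enorm_continuous|exact: phi1_continuous].
rewrite -EFinD lee_fin; have [wE|wE] := leP w (Emax T).
  have ah : admissible T (fun t => enorm (h t)).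
    split => //; first by move=> t; rewrite curve_clamp.
    by move=> I u v uv; exact: le_trans (eh _ _ _ uv) wE.
  apply: (le_trans (VP ah)); rewrite /cost1 /penergy.
  have := ge_energy T0 eh; lra.
(* above 2 T^3 the energy alone exceeds the terminal gain *)
apply: (le_trans value_le0).
have t0 : 0 <= tint T (fun s => a s * phi1 (enorm (h s))).
  by apply: Rintegral_ge0 => s _; have /andP[a0 _] := aB s; rewrite mulr_ge0// phi1_ge0.
have hT := energy_le_itv eh (lexx 0) (ltW T0) (lexx T).
suff : T * enorm (h T) <= w by lra.
rewrite -(@ler_pXn2r _ 2)// ?nnegrE ?mulr_ge0 ?(ltW T0)// exprMn.
rewrite enorm0 !subr0 in hT.
apply: (@le_trans _ _ (T ^+ 2 * (2 * w * T))); first by rewrite ler_pM2l// exprn_gt0.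
rewrite (_ : _ * _ = Emax T * w); last by rewrite /Emax; ring.
by rewrite expr2; apply: ler_wpM2r => //; exact: ltW.
Qed.

Lemma action_ray b f (af : admissible T f) : (action (ray b af) <= (cost1 T a f)%:E)%E.
Proof.
have [f0 fge fT fE] := af; have acf := energy_le_ac T0 fE fT.
have [q0 [q0i _ dq0]] := ac_FTC T0 acf.
have mq0 : measurable_fun setT q0 by have /integrableP[/measurable_EFinP] := q0i.
pose q i s := if i == i0 then (-1) ^+ b * q0 s else 0.
have mq i : measurable_fun setT (q i).
  by rewrite /q; case: eqP => // _; exact: measurable_funM.
have dq : {ae mu, forall s, 0 < s < T -> derive1 (ray b af) s = \row_i q i s}.
  apply: filterS dq0; first exact: (ae_filter_ringOfSetsType mu).
  move=> s /= H sT; have {}H := H sT.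
  have Hi i : is_derive s 1 (fun t => ray b af t ord0 i) (q i s).
    rewrite /q; have [->|ii] := eqVneq i i0.
      rewrite (_ : (fun t => _) = ((-1) ^+ b) \*: f); last first.
        by apply/funext => t; rewrite /= mxE eqxx.
      exact: is_deriveZ.
    rewrite (_ : (fun t => _) = cst 0); first exact: is_derive_cst.
    by apply/funext => t; rewrite /= mxE (negbTE ii).
  have dh : derivable (ray b af : R -> _) s 1.
    by apply/derivable_mxP => i j; rewrite ord1; have [] := Hi j.
  by rewrite derive1E derive_mx//; apply/rowP => i; rewrite !mxE; have [] := Hi i.
rewrite (action_density mq dq).
have nr s : enorm (ray b af s) = f s by rewrite axis_sign ger0_norm.
have -> : (fun s => a s * phi1 (enorm (ray b af s))) = (fun s => a s * phi1 (f s)).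
  by apply/funext => s; rewrite nr.
rewrite nr.
have -> : (\int[mu]_(s in `[0%R, T]) (2^-1 * \sum_i q i s ^+ 2)%:E =
    \int[mu]_(s in `[0%R, T]) (2^-1 * q0 s ^+ 2)%:E)%E.
  apply: eq_integral => s _; rewrite (bigD1 i0)//= /q eqxx big1 ?addr0.
    by rewrite exprMn sqrr_sign mul1r.
  by move=> i /negbTE ->; rewrite expr0n.
rewrite (_ : cost1 T a f = energy T f + (tint T (fun s => a s * phi1 (f s)) - T * f T)).
  rewrite [leRHS]EFinD; apply: leeD => //; apply: integral_sqr_derive_le => //.
    exact: energy_le_energy fE.
  exact: dq0.
by rewrite /cost1 /penergy; ring.
Qed.

End curves_in_space.

(** * Borel functions *)
Section borel_functions.
Context {R : realType}.

Lemma continuous_borel_measurable (Y : ptopologicalType) (f : Y -> R) :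
  continuous f -> measurable_fun setT (f : borel Y -> R).
Proof.
move=> /continuousP cf.
apply: (measurability _ (@RGenOpens.measurableE R)) => _ [_ [x [y ->]] <-].
rewrite setTI; apply: sub_sigma_algebra; apply: cf; exact: interval_open.
Qed.

Context {d : nat}.

Lemma coord_enorm_continuous : continuous (@enorm R d).
Proof. by apply: (@enorm_continuous R d 'rV[R]_d id) => i; exact: coord_continuous. Qed.

Lemma phi_continuous : continuous (@phi R d).
Proof.
move=> x; apply: (@continuous_comp _ _ _ (@enorm R d) phi1); first exact: coord_enorm_continuous.
exact: phi1_continuous.
Qed.

Lemma measurable_phi : measurable_fun setT (phi : borel 'rV[R]_d -> R).
Proof. exact: (continuous_borel_measurable phi_continuous). Qed.

Lemma measurable_enorm : measurable_fun setT (enorm : borel 'rV[R]_d -> R).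
Proof. exact: (continuous_borel_measurable coord_enorm_continuous). Qed.

End borel_functions.

(** * Uniform topology on curves *)
Section uniform_topology.
Context {R : realType} {d : nat}.
Variable T : R.

Lemma open_curve (U : set (curve d T)) (g : curve d T) : open U -> U g ->
  exists2 e : R, 0 < e & forall h : curve d T,
    (forall t i, `|g t ord0 i - h t ord0 i| < e) -> U h.
Proof.
move=> [W oW <-] Wg.
have /uniform_nbhs[E [entE EW]] : nbhs (\val g : {uniform R -> 'rV[R]_d}) W by exact: open_nbhs_nbhs.
move: entE; rewrite -entourage_ballE => -[e /= e0 eE].
exists e => // h gh; apply: EW => /= t _; apply: eE => /=.
by split=> // i j; rewrite ord1; exact: gh.
Qed.

Lemma nbhs_curve (g : curve d T) (e : R) : 0 < e ->
  nbhs g [set h : curve d T | forall t i, `|g t ord0 i - h t ord0 i| < e].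
Proof.
move=> e0; have c : {for g, continuous (set_val : curve d T -> {uniform R -> 'rV[R]_d})}.
  exact: initial_continuous.
have N : nbhs (\val g : {uniform R -> 'rV[R]_d})
    [set h | forall t i, `|\val g t ord0 i - h t ord0 i| < e].
  apply/uniform_nbhs; exists [set xy | ball xy.1 e xy.2]; split.
    by rewrite -entourage_ballE; exists e.
  by move=> h gh t i; have [_ /(_ ord0 i)] := gh t Logic.I.
exact: (c _ N).
Qed.

End uniform_topology.

(** * The law of the random ray *)
Local Notation eval := Defs.eval.

Section random_ray.
Context {R : realType} {d : nat}.
Variables (i0 : 'I_d) (T : R).
Hypothesis T0 : 0 < T.
Variables (a : R -> R) (V : R) (X : R -> R -> R) (Y : nat -> R -> R -> R).
Hypotheses (ca : continuous a) (aB : forall s, 0 <= a s <= phimax T)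
  (VP : forall f, admissible T f -> V <= cost1 T a f)
  (aX : forall w, admissible T (X w)) (XV : forall w, cost1 T a (X w) <= V)
  (Xa : forall s, (\int[@lebesgue_measure R]_(w in `[0%R, 1%R[) (phi1 (X w s))%:E = (a s)%:E)%E)
  (YX : forall k w t, `|Y k w t - X w t| <= mesh k)
  (mY : forall k (P : (R -> R) -> Prop),
    measurable ([set w | P (Y k w)] : set (measurableTypeR R))).

Lemma ray_coord b f (af : admissible T f) t i :
  ray i0 T0 b af t ord0 i = if i == i0 then (-1) ^+ b * f t else 0.
Proof. by rewrite /= mxE. Qed.

Lemma ray_dist b f g (af : admissible T f) (ag : admissible T g) t i :
  `|ray i0 T0 b af t ord0 i - ray i0 T0 b ag t ord0 i| <= `|f t - g t|.
Proof.
by rewrite !ray_coord; case: eqP => _; rewrite ?subrr ?normr0// -mulrBr normrM normr_sign mul1r.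
Qed.

Definition random_ray b (w : measurableTypeR R) : borel (curve d T) := ray i0 T0 b (aX w).

(** X w lies in an open set U if and only if, for some k, U contains all the rays
    within mesh k of the approximation Y k w; each of these conditions on Y k w
    defines a measurable event. *)
Lemma measurable_random_ray b : measurable_fun setT (random_ray b).
Proof.
apply: (@measurability _ _ _ _ setT (random_ray b) (@open (curve d T))) => // _ [U oU <-].
pose N k f := forall g (ag : admissible T g),
  (forall t, `|f t - g t| <= mesh k) -> U (ray i0 T0 b ag).
rewrite setTI (_ : _ @^-1` _ = \bigcup_k [set w | N k (Y k w)]).
  by apply: bigcup_measurable => k _; exact: (mY k (N k)).
apply/seteqP; split => w /=; last by move=> [k _ /= H]; apply: H.
move=> Uw; have [e e0 eU] := open_curve oU Uw.
have : \forall k \near \oo, mesh k < e / 2.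
  by apply: (cvgr_lt 0 (@mesh_cvg R)); rewrite divr_gt0.
move=> [k _ /(_ k (leqnn k)) /= ke]; exists k => // g ag Yg; apply: eU => t i.
apply: (le_lt_trans (ray_dist _ _ _ _ _)).
have -> : X w t - g t = (Y k w t - g t) - (Y k w t - X w t) by ring.
apply: (le_lt_trans (ler_normB _ _)).
have := Yg t; have := YX k w t; lra.
Qed.

HB.instance Definition _ b :=
  isMeasurableFun.Build _ _ _ _ (random_ray b) (measurable_random_ray b).

Definition uniform01 : probability (measurableTypeR R) R := uniform_prob (@ltr01 R).

Definition ray_law b : probability (borel (curve d T)) R := distribution uniform01 (random_ray b).

Lemma enorm_random_ray b w s : enorm ((random_ray b w : curve d T) s) = X w s.
Proof. by have [_ X0 _ _] := aX w; rewrite /= axis_sign ger0_norm. Qed.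

Lemma integral_marginal b s (F : R -> R) :
  measurable_fun setT (fun x : borel 'rV[R]_d => F (enorm x)) -> (forall x, 0 <= F x) ->
  (\int[distribution (ray_law b) (eval s)]_x (F (enorm x))%:E =
   \int[uniform01]_w (F (X w s))%:E)%E.
Proof.
move=> mF F0; rewrite ge0_integral_distribution//; last 2 first.
- exact/measurable_EFinP.
- by move=> y; rewrite lee_fin.
rewrite ge0_integral_distribution//; last 2 first.
- by apply: measurableT_comp; [exact/measurable_EFinP|exact: measurable_eval].
- by move=> y; rewrite lee_fin.
by apply: eq_integral => w _; rewrite /= -(enorm_random_ray b w s).
Qed.

Lemma measurable_phi1_X s : measurable_fun setT (fun w : measurableTypeR R => (phi1 (X w s))%:E).
Proof.
apply/measurable_EFinP.
rewrite (_ : (fun w => _) = (phi : borel 'rV[R]_d -> R) \o (eval s \o random_ray false)).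
  apply: measurableT_comp; first exact: measurable_phi.
  by apply: measurableT_comp; [exact: measurable_eval|exact: measurable_random_ray].
by apply/funext => w; rewrite /= /phi /eval enorm_random_ray.
Qed.

Lemma integral_phi1_X s : (\int[uniform01]_w (phi1 (X w s))%:E = (a s)%:E)%E.
Proof.
have mX := @measurable_phi1_X s.
rewrite integral_uniform//; last by move=> w; rewrite lee_fin phi1_ge0.
rewrite subr0 invr1 mul1e -integral_itv_bndo_bndc ?Xa//.
exact: measurable_funS mX.
Qed.

Lemma integral_marginal_phi b s :
  (\int[distribution (ray_law b) (eval s)]_x (phi x)%:E = (a s)%:E)%E.
Proof.
rewrite (@integral_marginal b s phi1); [exact: integral_phi1_X|exact: measurable_phi|exact: phi1_ge0].
Qed.

Lemma mean_marginal_phi b s :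
  \int[distribution (ray_law b) (eval s)]_x phi x = a s.
Proof. by rewrite /Rintegral integral_marginal_phi. Qed.

Lemma P2_marginal b s : P2 (distribution (ray_law b) (eval s)).
Proof.
rewrite /P2 (@integral_marginal b s (fun x => x ^+ 2)); last 2 first.
- by apply: measurable_funX; exact: measurable_enorm.
- by move=> x; exact: sqr_ge0.
apply: (@le_lt_trans _ _ (\int[uniform01]_w (fmax T ^+ 2)%:E)%E); last first.
  by rewrite integral_cst//= [X in (_ * X)%E]probability_setT mule1 ltry.
apply: ge0_le_integral => //.
- by move=> w _; rewrite lee_fin sqr_ge0.
- apply/measurable_EFinP.
  rewrite (_ : (fun w => _) = (fun x : borel 'rV[R]_d => enorm x ^+ 2) \o (eval s \o random_ray b)).
    apply: measurableT_comp; first by apply: measurable_funX; exact: measurable_enorm.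
    by apply: measurableT_comp; [exact: measurable_eval|exact: measurable_random_ray].
  by apply/funext => w; rewrite /= /eval enorm_random_ray.
- by move=> w _; rewrite lee_fin ler_pXn2r// ?nnegrE ?fmax_ge0 ?admissible_le//; have [] := aX w.
Qed.

Lemma cost_action b (g : curve d T) :
  cost lagrangian (final_coupling T) (ray_law b) g = action T a g.
Proof.
rewrite /cost /action; congr (_ + _)%E.
by apply: eq_integral => s _; rewrite /lagrangian /running_coupling mean_marginal_phi.
Qed.

(** A curve of the support is a uniform limit of rays of cost at most V, hence is such
    a ray itself, and V is a lower bound for all the competitors. *)
Lemma msupport_ray_law b :
  msupport (ray_law b) `<=` minimizers lagrangian (final_coupling T) (ray_law b) 0.
Proof.
move=> g0 gsupp; set g : curve d T := g0.
have near_ray k : exists w, forall t i,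
    `|g t ord0 i - (random_ray b w : curve d T) t ord0 i| < mesh k.
  have := nbhs_curve g (mesh_gt0 k); rewrite nbhsE => -[U [oU Ug] UN].
  have : (0 < ray_law b U)%E by exact: gsupp.
  apply: contraPP => no; apply/negP; rewrite -leNgt.
  have E : random_ray b @^-1` U = set0.
    by apply/seteqP; split => // w /= Uw; apply: no; exists w; exact: UN.
  by rewrite /ray_law /distribution /= /pushforward E measure0.
pose w k := projT1 (cid (near_ray k)).
have wP k : forall t i, `|g t ord0 i - (random_ray b (w k) : curve d T) t ord0 i| < mesh k.
  exact: projT2 (cid (near_ray k)).
pose x t := (-1) ^+ b * g t ord0 i0.
have yx k t : `|X (w k) t - x t| <= mesh k.
  have := wP k t i0; rewrite ray_coord eqxx => /ltW; apply: le_trans.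
  rewrite (_ : X (w k) t - x t = - ((-1) ^+ b * (g t ord0 i0 - (-1) ^+ b * X (w k) t))).
    by rewrite normrN normrM normr_sign mul1r.
  by rewrite mulrBr mulrA -expr2 sqrr_sign mul1r opprB.
have ax : admissible T x by apply: (@admissible_limit _ _ (fun k => X (w k)) _ _ yx) => k; exact: aX.
have gE : g = ray i0 T0 b ax.
  apply/val_inj/funext => t; apply/rowP => i; rewrite -[RHS]/(ray i0 T0 b ax t ord0 i) ray_coord.
  have [->|ii] := eqVneq i i0; first by rewrite /x mulrA -expr2 sqrr_sign mul1r.
  apply/eqP; rewrite -normr_le0; apply: (ler_cvg_to (cvg_cst _) (@mesh_cvg R)).
  apply: nearW => k; have := wP k t i; rewrite ray_coord (negbTE ii) subr0.
  exact: ltW.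
have xV : cost1 T a x <= V.
  by apply: (cost1_limit T0 ca aB _ yx) => k; [exact: aX|apply: (le_trans (XV _)); rewrite lerDl ltW// mesh_gt0].
split; first by rewrite -/g gE; apply/rowP => i; have [x0 _ _ _] := ax; rewrite ray_coord x0 mulr0 mxE; case: ifP.
move=> h h0; rewrite -/g !cost_action gE.
apply: (le_trans (action_ray i0 T0 ca aB b ax)).
by apply: (@le_trans _ _ V%:E); [rewrite lee_fin|exact: (action_ge T0 ca aB VP)].
Qed.

Lemma random_ray0 b w : (random_ray b w : curve d T) 0 = 0.
Proof.
apply/rowP => i; have [x0 _ _ _] := aX w; rewrite ray_coord x0 mulr0 mxE; by case: ifP.
Qed.

(** Since the initial law is a Dirac mass, the constant kernel is a disintegration. *)
Lemma equilibrium_ray_law b :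
  equilibrium lagrangian (final_coupling T) (\d_(0 : borel 'rV[R]_d)) (ray_law b).
Proof.
split.
- move=> A mA.
  rewrite /distribution /= /pushforward /= diracE.
  have [A0|A0] := boolP (0 \in A).
    rewrite (_ : _ @^-1` _ = setT) ?probability_setT//.
    by apply/seteqP; split => // w _ /=; rewrite /eval random_ray0; exact/set_mem.
  rewrite (_ : _ @^-1` _ = set0) ?measure0//.
  apply/seteqP; split => // w /=; rewrite /eval random_ray0 => /mem_set A0'.
  by rewrite A0' in A0.
- by move=> s _; exact: P2_marginal.
have mk : measurable_fun [set: borel 'rV[R]_d]
    (fun=> ray_law b : pprobability (borel (curve d T)) R) by exact: measurable_cst.
have ae0 (P : set (borel 'rV[R]_d)) : P 0 -> {ae \d_(0 : borel 'rV[R]_d), forall x, P x}.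
  move=> P0; exists (~` [set 0]); split.
  - apply: sub_sigma_algebra; apply: closed_openC.
    exact: accessible_closed_set1 (hausdorff_accessible (@norm_hausdorff _ _)) _.
  - by rewrite diracE memNset//=; apply.
  - by move=> x; apply: contra_not => ->.
exists (kprobability mk).
  split=> [A mA|].
    by rewrite integral_dirac//= diracT mul1e.
  apply: ae0; rewrite /= /kprobability.
  rewrite /ray_law /distribution /= /pushforward /=.
  rewrite (_ : _ @^-1` _ = setT) ?probability_setT//.
  by apply/seteqP; split => // w _ /=; rewrite random_ray0.
by apply: ae0; exact: msupport_ray_law.
Qed.

(** The event that separates the two laws. *)
Definition upward : set (borel (curve d T)) := [set g | 0 < (g : curve d T) T ord0 i0].

Lemma measurable_upward : measurable upward.
Proof.
apply: sub_sigma_algebra.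
have /continuousP : continuous (fun g : curve d T => g T ord0 i0).
  move=> g; apply: (@continuous_comp _ _ _ (fun g : curve d T => g T) (fun x : 'rV[R]_d => x ord0 i0)).
    exact: continuous_eval.
  exact: coord_continuous.
move=> /(_ `]0, +oo[%classic); rewrite /upward.
rewrite (_ : _ @^-1` _ = [set g | 0 < (g : curve d T) T ord0 i0]).
  by apply; apply: interval_open.
by apply/seteqP; split => g; rewrite /= in_itv/= andbT.
Qed.

Lemma disjoint_itvs_length (S : R) (I : finType) (u v : I -> R) :
  0 < S -> disjoint_itvs S u v -> \sum_i (v i - u i) <= S.
Proof.
move=> S0 [uvS tuv].
pose J i : set (measurableTypeR R) := `]u i, v i[%classic.
have mJ i : measurable (J i) by exact: measurable_itv.
have muJ i : lebesgue_measure (J i) = (v i - u i)%:E.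
  have [_ uv _] := uvS i; rewrite lebesgue_measure_itv/= lte_fin.
  by case: ltgtP uv => // -> _; rewrite subrr.
rewrite -lee_fin -sumEFin.
rewrite (eq_bigr (fun i => \int[lebesgue_measure]_(s in J i) (cst 1%E s))%E); last first.
  by move=> i _; rewrite integral_cst//= [X in (_ * X)%E]muJ mul1e.
rewrite -ge0_integral_bigsetU//=; [|exact: index_enum_uniq|exact: sub_trivIset tuv].
have mU : measurable (\big[setU/set0]_i J i) by apply: bigsetU_measurable => i _.
have <- : lebesgue_measure (`[0, S]%classic : set (measurableTypeR R)) = S%:E.
  by rewrite lebesgue_measure_itv/= lte_fin S0 -EFinB subr0.
rewrite integral_cst//= mul1e; apply: le_measure; rewrite ?inE//.
rewrite -bigcup_seq => s [i _]; rewrite /J/= !in_itv/= => /andP[us sv].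
have [u0 _ vS] := uvS i.
by rewrite (le_trans u0 (ltW us)) (le_trans (ltW sv) vS).
Qed.

(** Uniform motion at speed T: without congestion it costs T^3/2 - T^3 < 0. *)
Definition linear_motion (t : R) : R := T * clamp T t.

Lemma linear_motion_energy : energy_le T linear_motion (T ^+ 3 / 2).
Proof.
move=> I u v uv; have [uvT _] := uv.
apply: (@le_trans _ _ (\sum_i (T ^+ 2 / 2) * (v i - u i))).
  apply: ler_sum => i _; have [u0 ui vT] := uvT i.
  rewrite /linear_motion !clamp_id ?u0 ?vT ?(le_trans u0 ui) ?(le_trans ui vT)//.
  rewrite -mulrBr exprMn; have [->|uvi] := eqVneq (v i) (u i).
    by rewrite subrr expr0n !mulr0 mul0r.
  rewrite le_eqVlt; apply/orP; left; apply/eqP.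
  by field; rewrite subr_eq0.
rewrite -mulr_sumr (_ : T ^+ 3 / 2 = T ^+ 2 / 2 * T); last by rewrite exprSr; field.
by rewrite ler_pM2l ?divr_gt0 ?exprn_gt0//; exact: disjoint_itvs_length uv.
Qed.

Lemma linear_motion_admissible : admissible T linear_motion.
Proof.
have T3 : 0 < T ^+ 3 by rewrite exprn_gt0.
split.
- by rewrite /linear_motion clamp_id ?mulr0// lexx ltW.
- by move=> t; rewrite mulr_ge0 ?(ltW T0)//; have /andP[] := clamp_itv T0 t.
- by move=> t; rewrite /linear_motion clampK.
- by move=> I u v uv; apply: (le_trans (linear_motion_energy uv)); rewrite /Emax; lra.
Qed.

(** A curve that ends at the origin costs at least its energy, and V <= 0, so it is the
    rest curve. If almost all the curves are, then a = 0, and V = 0 is contradicted by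
    linear_motion. *)
Lemma reaches_final_time : (uniform01 [set w | (0 < X w T)%R] <> 0)%E.
Proof.
set N := [set w | _] => N0.
have XT w : ~ N w -> X w T = 0.
  by have [_ X0 _ _] := aX w; move=> /negP; rewrite -leNgt => ?; apply/eqP; rewrite eq_le X0 andbT.
have t0 w : 0 <= tint T (fun s => a s * phi1 (X w s)).
  by apply: Rintegral_ge0 => s _; have /andP[a0 _] := aB s; rewrite mulr_ge0// phi1_ge0.
have Vle0 := value_le0 T0 VP.
have X0 w s : ~ N w -> X w s = 0.
  move=> /XT XT0; have [X00 _ XC XE] := aX w; rewrite XC.
  have eX : energy T (X w) <= 0.
    by have := XV w; rewrite /cost1 /penergy XT0 mulr0; have := t0 w; lra.
  have /andP[c0 cT] := clamp_itv T0 s.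
  have := energy_le_itv (energy_le_energy T0 XE) (lexx 0) c0 cT.
  rewrite X00 !subr0 => h; apply/eqP; rewrite -sqrf_eq0 eq_le sqr_ge0 andbT.
  by apply: (le_trans h); rewrite mulr_le0_ge0// mulr_ge0_le0.
have mN : measurable (N : set (measurableTypeR R)).
  rewrite (_ : N = random_ray false @^-1` upward).
    by rewrite -[X in measurable X]setTI; apply: measurable_random_ray => //; exact: measurable_upward.
  by apply/seteqP; split => w; rewrite /upward /= ray_coord eqxx mul1r.
have aeN : {ae uniform01, forall w, ~ N w} by exists N; split => // w /= /contrapT.
have a0 s : a s = 0.
  have /andP[as0 _] := aB s; apply/eqP; rewrite eq_le as0 andbT -lee_fin -integral_phi1_X.
  rewrite -[leRHS](@integral0 _ _ _ uniform01 setT); apply: ge0_ae_le_integral => //.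
    by move=> w; rewrite lee_fin phi1_ge0.
  apply: filterS aeN; first exact: (ae_filter_ringOfSetsType uniform01).
  by move=> w /= /X0 Xw _; rewrite Xw phi1_0.
have [w Nw] : exists w, ~ N w.
  apply: contrapT => allN; have NT : N = setT.
    by apply/seteqP; split => // w _; apply: contrapT => Nw; apply: allN; exists w.
  by move: N0; rewrite NT probability_setT => /eqP; rewrite onee_eq0.
have V0 : 0 <= V.
  apply: le_trans (XV w); rewrite /cost1 /penergy (XT w Nw) mulr0 subr0.
  by rewrite addr_ge0//; have [_ _ _ XE] := aX w; exact: energy_ge0 T0 XE.
have := VP linear_motion_admissible; rewrite /cost1 /penergy.
rewrite (_ : (fun s => _) = fun=> 0); last by apply/funext => s; rewrite a0 mul0r.
have -> : linear_motion T = T * T by rewrite /linear_motion clamp_id// lexx ltW.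
rewrite (tint_cst T0) mulr0 addr0 => Vl.
have := ge_energy T0 linear_motion_energy.
have T3 : 0 < T ^+ 3 by rewrite exprn_gt0.
move=> El; have : 0 <= T ^+ 3 / 2 - T * (T * T).
  by apply: (le_trans V0); apply: (le_trans Vl); rewrite lerD2r.
by rewrite (_ : _ - _ = - (T ^+ 3 / 2)); [rewrite oppr_ge0 leNgt divr_gt0|field].
Qed.

Lemma ray_law_upward : ray_law false upward <> ray_law true upward.
Proof.
have -> : ray_law false upward = uniform01 [set w | 0 < X w T].
  rewrite /ray_law /distribution /= /pushforward; congr (uniform01 _).
  by apply/seteqP; split => w; rewrite /upward /= ray_coord eqxx mul1r.
suff -> : ray_law true upward = 0%E by exact: reaches_final_time.
rewrite /ray_law /distribution /= /pushforward (_ : _ @^-1` _ = set0) ?measure0//.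
apply/seteqP; split => // w; rewrite /upward /= ray_coord eqxx mulN1r oppr_gt0.
by have [_ X0 _ _] := aX w; rewrite ltNge X0.
Qed.

End random_ray.

Lemma two_equilibria (R : realType) (d : nat) (hd : (0 < d)%N) (T : R) (T0 : 0 < T) :
  exists eta1 eta2 : probability (borel (curve d T)) R,
    [/\ equilibrium lagrangian (final_coupling T)
          (\d_(0 : borel 'rV[R]_d)) eta1,
        equilibrium lagrangian (final_coupling T)
          (\d_(0 : borel 'rV[R]_d)) eta2 &
        exists2 A : set (borel (curve d T)), measurable A & eta1 A <> eta2 A].
Proof.
have [a [V [X [Y [[ca aB VP aX] [XV Xa YX _ mY]]]]]] := random_equilibrium T0.
pose eta b := @ray_law R d (Ordinal hd) T T0 X Y aX YX mY b.
exists (eta false), (eta true); split.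
- exact: (equilibrium_ray_law (Ordinal hd) T0 ca aB VP aX XV Xa).
- exact: (equilibrium_ray_law (Ordinal hd) T0 ca aB VP aX XV Xa).
- by exists (upward (Ordinal hd) (T := T)); [exact: measurable_upward|exact: (ray_law_upward aB VP XV Xa)].
Qed.

(** * Strong monotonicity of the coupling *)
Section strong_monotonicity.
Context {R : realType} {d : nat}.
Implicit Types m : probability (borel 'rV[R]_d) R.

Lemma phi_integrable m : P2 m -> m.-integrable setT (EFin \o phi).
Proof.
move=> m2; have phi_le x : phi x <= 1 + (@enorm R d x) ^+ 2.
  have e0 := enorm_ge0 x; set e := enorm x in e0 *.
  have p2 : phi x ^+ 2 = 2 * e by rewrite sqr_sqrtr// mulr_ge0.
  rewrite -(@ler_pXn2r _ 2)// ?nnegrE ?sqrtr_ge0 ?addr_ge0 ?sqr_ge0// p2.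
  have h1 : 0 <= (e - 1) ^+ 2 by exact: sqr_ge0.
  have h2 : 0 <= e ^+ 2 * (1 + e ^+ 2) by rewrite mulr_ge0 ?addr_ge0 ?sqr_ge0.
  by nra.
apply: (@le_integrable _ _ _ m setT _ _ (fun x => (1 + enorm x ^+ 2)%:E)) => //.
- by apply/measurable_EFinP; exact: measurable_phi.
- move=> x _ /=; rewrite lee_fin !ger0_norm ?sqrtr_ge0 ?addr_ge0 ?sqr_ge0//.
- apply/integrableP; split.
    apply/measurable_EFinP; apply: measurable_funD => //; apply: measurable_funX; exact: measurable_enorm.
  under eq_integral do rewrite gee0_abs ?lee_fin ?addr_ge0 ?sqr_ge0// EFinD.
  rewrite ge0_integralD//.
  + by rewrite integral_cst//= probability_setT mule1 lte_add_pinfty ?ltry.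
  + by move=> x _; rewrite lee_fin sqr_ge0.
  + by apply/measurable_EFinP; apply: measurable_funX; exact: measurable_enorm.
Qed.

Lemma running_coupling_strongly_monotone : LL_strongly_monotone (@running_coupling R d).
Proof.
have diffE m1 m2 : P2 m1 -> P2 m2 ->
    integral_diff (fun x => running_coupling x m1 - running_coupling x m2) m1 m2 =
    (\int[m1]_x phi x - \int[m2]_x phi x) ^+ 2.
  move=> i1 i2; rewrite /integral_diff /running_coupling.
  set c1 := \int[m1]_x phi x; set c2 := \int[m2]_x phi x.
  under eq_Rintegral do rewrite -mulrBr.
  under [X in _ - X]eq_Rintegral do rewrite -mulrBr.
  rewrite !RintegralZr//; [|exact: phi_integrable|exact: phi_integrable].
  by rewrite -/c1 -/c2 -mulrBl expr2.
have diff_integrable m m1 m2 : P2 m ->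
    m.-integrable setT (EFin \o (fun x => running_coupling x m1 - running_coupling x m2)).
  move=> i; rewrite (_ : _ \o _ = (fun x => (\int[m1]_x phi x - \int[m2]_x phi x)%:E * (phi x)%:E)%E).
    exact: (integrableZl measurableT _ (phi_integrable i)).
  by apply/funext => x; rewrite /= -EFinM /running_coupling -mulrBr mulrC.
split=> [m1 m2 i1 i2 f|m1 m2 i1 i2].
  by split; [exact: diff_integrable|exact: diff_integrable|rewrite diffE// sqr_ge0].
rewrite diffE// => /eqP; rewrite sqrf_eq0 subr_eq0 => /eqP c12 x.
by rewrite /running_coupling c12.
Qed.

End strong_monotonicity.

Theorem proposition3p6 (R : realType) (d : nat) (hd : (0 < d)%N)
    (T : R) (hT : 0 < T) :
  LL_strongly_monotone (@running_coupling R d) /\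
  exists eta1 eta2 : probability (borel (curve d T)) R,
    [/\ equilibrium lagrangian (final_coupling T)
          (\d_(0 : borel 'rV[R]_d)) eta1,
        equilibrium lagrangian (final_coupling T)
          (\d_(0 : borel 'rV[R]_d)) eta2 &
        exists2 A : set (borel (curve d T)), measurable A & eta1 A <> eta2 A].
Proof.
split; first exact: running_coupling_strongly_monotone.
exact: two_equilibria.
Qed.
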